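(* Let $n\ge2$ and $a>-2$, and put $p_{c}(a):=\frac{n+2+2a}{n-2}$ if $n\ge3$ and $p_{c}(a):=\infty$ if $n=2$. Then for every $0<p<p_{c}(a)$ the equation $$-\Delta u(x)=|x|^{a}u^{p}(x)\quad\text{in }\mathbb{R}^{n}$$ has no positive solution in $\mathbb{R}^{n}$ (in the regularity class specified in the context).
   Context: Solutions are functions $u\in C^{2}(\mathbb{R}^{n})$ when $a\ge0$, and $u\in C^{2}(\mathbb{R}^{n}\setminus\{0\})\cap C(\mathbb{R}^{n})$ when $-2<a<0$, satisfying the equation pointwise (for $a<0$, at all $x\neq0$). A positive solution is one with $u>0$ in $\mathbb{R}^{n}$. *)

(* Defs.v *)
From HB Require Import structures.
From mathcomp Require Import all_boot all_order all_algebra.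
From mathcomp Require Import all_classical all_reals all_analysis.

Set Implicit Arguments.
Unset Strict Implicit.
Unset Printing Implicit Defensive.

Import Order.TTheory GRing.Theory Num.Theory.
Import numFieldNormedType.Exports.

Local Open Scope classical_set_scope.
Local Open Scope ring_scope.

(* R^n is 'rV[R]_n. The library norm `|x| on 'rV[R]_n is the sup norm, which
   induces the right topology but is not the |x| of the equation. *)
Definition enorm (R : realType) (n : nat) (x : 'rV[R]_n) : R :=
  Num.sqrt (\sum_(i < n) x ord0 i ^+ 2).

Definition partial (R : realType) (n : nat) (i : 'I_n) (f : 'rV[R]_n -> R)
  : 'rV[R]_n -> R := 'D_(delta_mx ord0 i) f.

(* Continuity is that of the ambient space, so C1_on and C2_on are the usual
   classes when A is open, as it is in both uses below. *)
Definition C1_on (R : realType) (n : nat) (A : set 'rV[R]_n)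
    (f : 'rV[R]_n -> R) : Prop :=
  (forall x, A x -> {for x, continuous f}) /\
  (forall (i : 'I_n) x, A x ->
     derivable f x (delta_mx ord0 i) /\ {for x, continuous (partial i f)}).

Definition C2_on (R : realType) (n : nat) (A : set 'rV[R]_n)
    (f : 'rV[R]_n -> R) : Prop :=
  C1_on A f /\ forall i : 'I_n, C1_on A (partial i f).

Definition laplacian (R : realType) (n : nat) (f : 'rV[R]_n -> R)
    (x : 'rV[R]_n) : R :=
  \sum_(i < n) partial i (partial i f) x.

(* With powR, 0 `^ 0 = 1 and 0 `^ a = 0 for a > 0, as wanted at the origin.
   The value of u x `^ p is meaningful for u x >= 0 only. *)
Definition equation_at (R : realType) (n : nat) (a p : R) (u : 'rV[R]_n -> R)
    (x : 'rV[R]_n) : Prop :=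
  - laplacian u x = (enorm x `^ a) * (u x `^ p).

Definition solution (R : realType) (n : nat) (a p : R) (u : 'rV[R]_n -> R)
    : Prop :=
  (0 <= a /\ C2_on setT u /\ forall x, equation_at a p u x) \/
  (-2 < a < 0 /\ C2_on [set x : 'rV[R]_n | x != 0] u /\ continuous u /\
   forall x : 'rV[R]_n, x != 0 -> equation_at a p u x).

Definition positive_solution (R : realType) (n : nat) (a p : R)
    (u : 'rV[R]_n -> R) : Prop :=
  solution a p u /\ forall x, 0 < u x.

Definition critical_exponent (R : realType) (n : nat) (a : R) : \bar R :=
  if (3 <= n)%N then ((n%:R + 2 + 2 * a) / (n%:R - 2))%:E else +oo%E.

(* Main.v *)
(** Write t = ln |x|, k = (n-2)/2 and w(x) = |x|^k u(x).  In polar coordinates the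
    equation becomes  w_tt + Lap_S w = k^2 w - e^(b t) w^p  on the cylinder R x S^(n-1),
    where b = k + 2 + a - k p is positive exactly when p < p_c(a).  All arguments are
    maximum principles on this cylinder, whose compact cross-section makes minima over
    t1 <= t <= t2 exist and lets barriers depend on t alone.

    - Touching w from below by a multiple of sin(t - t0) on t0 < t < t0 + pi gives a point
      where e^(b t) w^(p-1) <= k^2 + 1.  This is absurd for large t0 as soon as w is bounded
      below on t >= 0 (if p > 1), or w = O(e^(k t)) at the touching point (if p <= 1).
      The latter holds since the minimum of u over spheres is nonincreasing in the radius.
    - For p > 1 and k = 0 the lower bound is comparison with affine functions of t.
    - For p > 1 and k > 0 it follows from the monotonicity of w in t, proved by moving
      planes t -> 2 s - t from s = -oo, i.e. by Kelvin transforms (moving spheres): as w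
      vanishes at t = -oo, nothing has to be known at t = +oo.  The strict monotonicity of
      e^(b t) excludes an interior zero of the difference directly, and a barrier depending
      on t alone gives the Hopf lemma on the plane itself. *)
From HB Require Import structures.
Require Import Defs.
From mathcomp Require Import all_boot all_order all_algebra.
From mathcomp Require Import all_classical all_reals all_analysis.
From mathcomp Require Import ring lra.

Set Implicit Arguments.
Unset Strict Implicit.
Unset Printing Implicit Defensive.

Import Order.TTheory GRing.Theory Num.Theory.
Import numFieldNormedType.Exports.

Local Open Scope classical_set_scope.
Local Open Scope ring_scope.

(** * One-variable calculus and the second derivative test *)

Lemma derive_lt0_right (R : realType) (f : R -> R) (l : R) :
  is_derive (0 : R) 1 f l -> l < 0 ->
  exists2 e, 0 < e & forall t, 0 < t < e -> f t < f 0.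
Proof.
move=> [df0 vf] l0.
have : (fun h : R => h^-1 *: ((f \o shift 0) (h *: 1) - f 0)) @ 0^' --> l.
  by rewrite -vf; exact: df0.
move=> /cvgr_lt /(_ _ l0) [e /= e0 He]; exists e => // t /andP[t0 te].
have := He t; rewrite /ball_/= sub0r normrN gtr0_norm// => /(_ te).
rewrite gt_eqF// => /(_ isT).
by rewrite addr0 [t%:A]mulr1 /GRing.scale/= pmulr_rlt0 ?invr_gt0// subr_lt0.
Qed.

Lemma is_derive_affine (R : realType) (f : R -> R) (c e t l : R) :
  is_derive (c + e * t) 1 f l -> is_derive t 1 (fun s => f (c + e * s)) (e * l).
Proof.
move=> D.
have D2 : is_derive t 1 (fun s : R => c + e * s) e.
  by apply: is_derive_eq; rewrite /GRing.scale/=; ring.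
by have := @is_derive1_comp _ f (fun s : R => c + e * s) _ _ _ D D2; rewrite mulrC.
Qed.

Lemma is_derive_compN (R : realType) (f : R -> R) (l t : R) :
  is_derive (- t) 1 f l -> is_derive t 1 (fun s => f (- s)) (- l).
Proof.
move=> D; have := @is_derive_affine R f 0 (-1) t l.
rewrite add0r mulN1r mulN1r => /(_ D).
by under eq_fun do rewrite add0r mulN1r.
Qed.

(** If [b] were negative, [f1] would be negative just to the right of 0, and the mean value theorem
    would give a value of [f] below [f 0]. The second derivative is asked for at 0 only. *)
Lemma second_derivative_test (R : realType) (f f1 : R -> R) (b d : R) :
  (forall t : R, is_derive t 1 f (f1 t)) -> is_derive (0 : R) 1 f1 b ->
  0 < d -> (forall t, `|t| < d -> f 0 <= f t) -> f1 0 = 0 /\ 0 <= b.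
Proof.
move=> df df1 d0 fmin.
have f10 : f1 0 = 0.
  have D : is_derive (0 : R) 1 f 0.
    apply: (@derive1_at_min _ f (- d) d) => [||//|t].
    - by rewrite ge0_cp// ltW.
    - by move=> t _; case: (df t).
    - by rewrite in_itv/= d0 oppr_lt0 d0.
    - by rewrite in_itv/= => /andP[t1 t2]; apply: fmin; rewrite ltr_norml t1 t2.
  by rewrite -(@derive_val _ _ _ _ _ _ _ (df 0)) (@derive_val _ _ _ _ _ _ _ D).
split=> //; rewrite leNgt; apply/negP => b0.
have [e e0 f1_lt0] := derive_lt0_right df1 b0.
have mm : 0 < Num.min d e by rewrite lt_min d0 e0.
pose m := Num.min d e / 2.
have m0 : 0 < m by rewrite /m divr_gt0.
have : m < Num.min d e by rewrite /m ltr_pdivrMr// ltr_pMr// ltr1n.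
rewrite lt_min => /andP[md me].
have [] := @MVT _ f f1 0 m m0.
  by apply: derivable_within_continuous => x _; case: (df x).
move=> c; rewrite in_itv/= => /andP[c0 cm] E.
have := fmin m; rewrite ger0_norm ?(ltW m0)// md => /(_ isT).
rewrite -subr_ge0 E subr0 pmulr_lge0// leNgt => /negP; apply.
by rewrite -f10 f1_lt0// c0 (lt_trans cm me).
Qed.

(** * Continuous partial derivatives imply differentiability *)

(** The candidate differential; [c] will be the family of partial derivatives at a point. *)
Definition row_form (R : realType) (n : nat) (c : 'I_n -> R) (v : 'rV[R]_n) : R :=
  \sum_(i < n) v ord0 i * c i.

Lemma row_form_is_linear (R : realType) (n : nat) (c : 'I_n -> R) :
  linear (row_form c : 'rV[R]_n -> R^o).
Proof.
move=> a v w; rewrite /row_form scaler_sumr -big_split/=; apply: eq_bigr => i _.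
by rewrite !mxE mulrDl -mulrA.
Qed.

HB.instance Definition _ (R : realType) (n : nat) (c : 'I_n -> R) :=
  GRing.isLinear.Build R 'rV[R]_n R^o _ (row_form c) (@row_form_is_linear R n c).

Lemma continuous_sum (R : realType) (T : topologicalType) (I : Type)
    (r : seq I) (F : I -> T -> R) (x : T) :
  (forall i, {for x, continuous (F i)}) ->
  {for x, continuous (fun y => \sum_(i <- r) F i y)}.
Proof.
move=> cF; elim: r => [|i r IH].
  rewrite (_ : (fun _ => _) = cst 0); last by apply/funext => y; rewrite big_nil.
  exact: cvg_cst.
rewrite (_ : (fun _ => _) = F i \+ (fun y => \sum_(j <- r) F j y)).
  by apply: cvgD; [exact: cF|exact: IH].
by apply/funext => y; rewrite big_cons.
Qed.

Lemma row_form_continuous (R : realType) (n : nat) (c : 'I_n -> R) :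
  continuous (row_form c).
Proof.
move=> v; rewrite /row_form.
apply: (@continuous_sum R _ _ _ (fun i (v : 'rV[R]_n) => v ord0 i * c i)) => i.
apply: (@continuousM _ _ (fun w : 'rV[R]_n => w ord0 i) (cst (c i))).
  exact: (@coord_continuous R 1 n ord0 i v).
exact: cst_continuous.
Qed.

Lemma is_derive_line (R : realType) (V : normedModType R) (f : V -> R) (y v : V)
    (s : R) :
  derivable f (y + s *: v) v ->
  is_derive s 1 (fun t : R => f (y + t *: v)) ('D_v f (y + s *: v)).
Proof.
move=> df.
have E : (fun h : R => h^-1 *: (((fun t : R => f (y + t *: v)) \o shift s) (h *: 1)
    - f (y + s *: v))) =
   (fun h => h^-1 *: ((f \o shift (y + s *: v)) (h *: v) - f (y + s *: v))).
  by apply/funext => h /=; rewrite scalerDl addrCA [h%:A]mulr1.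
by split; rewrite /derivable /derive E.
Qed.

(** Mean value theorem along the segment, parametrised by [0, 1] so that the sign of [a] does not
    matter. *)
Lemma partial_increment (R : realType) (V : normedModType R) (f : V -> R)
    (y v : V) (a c e : R) :
  (forall s : R, 0 <= s <= 1 -> derivable f (y + (s * a) *: v) v /\
     `|'D_v f (y + (s * a) *: v) - c| <= e) ->
  `|f (y + a *: v) - f y - a * c| <= e * `|a|.
Proof.
move=> H.
pose g (s : R) := f (y + (s * a) *: v).
have dg (s : R) : 0 <= s <= 1 -> is_derive s 1 g (a * 'D_v f (y + (s * a) *: v)).
  move=> /H[d _].
  have D1 := @is_derive_line R V f y v (s * a) d.
  have D2 : is_derive s 1 (fun s : R => s * a) a.
    by apply: is_derive_eq; rewrite ?scaler0 ?addr0 ?add0r /GRing.scale/= mulr1.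
  have := @is_derive1_comp _ (fun t : R => f (y + t *: v)) (fun s : R => s * a) _ _ _ D1 D2.
  by rewrite mulrC.
have [] := @MVT_segment R g (fun s => a * 'D_v f (y + (s * a) *: v)) 0 1 ler01.
- by move=> s; rewrite in_itv/= => /andP[s0 s1]; apply: dg; rewrite !ltW.
- apply: derivable_within_continuous => s; rewrite in_itv/= => s01.
  by case: (dg s s01).
move=> s; rewrite in_itv/= => s01; rewrite /g mul1r mul0r scale0r addr0 subr0 mulr1 => ->.
rewrite -mulrBr normrM mulrC ler_wpM2r//.
by case: (H s s01).
Qed.

(** The path from [x] to [x + h] changes one coordinate at a time; each of the [n] steps contributes
    an error of at most [e * |h|]. *)
Lemma C1_on_increment (R : realType) (n : nat) (f : 'rV[R]_n -> R) (x h : 'rV[R]_n)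
    (c : 'I_n -> R) (e : R) :
  0 <= e ->
  (forall y, `|y| <= `|h| -> forall i, derivable f (x + y) (delta_mx ord0 i) /\
     `|partial i f (x + y) - c i| <= e) ->
  `|f (x + h) - f x - row_form c h| <= n%:R * (e * `|h|).
Proof.
move=> e0 H.
have coordh i : `|h ord0 i| <= `|h|.
  by rewrite [leRHS]/Num.Def.normr/= mx_normrE; exact: (le_bigmax _ (fun i => `|h i.1
    i.2|) (ord0, i)).
have normle (y : 'rV[R]_n) : (forall i, `|y ord0 i| <= `|h ord0 i|) -> `|y| <= `|h|.
  move=> yh; rewrite [leLHS]/Num.Def.normr/= mx_normrE; apply: bigmax_le => //= -[i j] _ /=.
  by rewrite (ord1 i) (le_trans (yh j)).
(* The first [m] coordinates of [h], completed by zeros: the corners of the path. *)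
pose hm (m : nat) : 'rV[R]_n := \row_j (if (j < m)%N then h ord0 j else 0).
suff S m : (m <= n)%N ->
    `|f (x + hm m) - f x - row_form c (hm m)| <= m%:R * (e * `|h|).
  have E : hm n = h by apply/rowP => j; rewrite mxE ltn_ord.
  by have := S n (leqnn n); rewrite E.
elim: m => [_|m IH mn].
  have -> : hm 0%N = 0 by apply/rowP => j; rewrite !mxE.
  by rewrite addr0 subrr linear0 subr0 normr0 mul0r.
pose i := Ordinal mn.
have hmS : hm m.+1 = hm m + h ord0 i *: delta_mx ord0 i.
  apply/rowP => j; rewrite !mxE eqxx/= ltnS leq_eqVlt.
  have [->|jm] := eqVneq j i; first by rewrite /= eqxx ltnn add0r mulr1.
  have -> : (j == m :> nat) = false by apply/negP => /eqP E; case/eqP: jm; apply: val_inj.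
  by rewrite mulr0 addr0.
have B : `|f (x + hm m + h ord0 i *: delta_mx ord0 i) - f (x + hm m) - h ord0 i * c i|
    <= e * `|h ord0 i|.
  apply: partial_increment => s /andP[s0 s1]; rewrite -addrA; apply: H.
  apply: normle => j; rewrite !mxE eqxx/=.
  have [->|jm] := eqVneq j i.
    by rewrite /= ltnn add0r mulr1 normrM ger0_norm// ler_piMl.
  by rewrite mulr0 addr0; case: ifP; rewrite ?normr0.
rewrite hmS linearD/= addrA.
have -> : row_form c (h ord0 i *: delta_mx ord0 i) = h ord0 i * c i.
  rewrite linearZ/= /row_form (bigD1 i)//= big1 ?addr0.
    by rewrite mxE !eqxx mul1r.
  by move=> j ji; rewrite mxE (negbTE ji) andbF mul0r.
set F1 := f (x + hm m + _) in B *; set F0 := f (x + hm m) in B IH *.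
have -> : F1 - f x - (row_form c (hm m) + h ord0 i * c i) =
   (F0 - f x - row_form c (hm m)) + (F1 - F0 - h ord0 i * c i) by ring.
apply: (le_trans (ler_normD _ _)); rewrite -[m.+1]addn1 natrD mulrDl mul1r lerD//.
  by apply: IH; exact: ltnW.
by apply: (le_trans B); rewrite ler_wpM2l.
Qed.

(** Near [x] the partial derivatives are close to their values at [x], so the increment bound is
    o(|h|). Full differentiability is what permits the chain rule along rays and circles. *)
Lemma C1_on_differentiable (R : realType) (n : nat) (A : set 'rV[R]_n)
    (f : 'rV[R]_n -> R) (x : 'rV[R]_n) :
  open A -> C1_on A f -> A x ->
  differentiable f x /\
  forall v, 'D_v f x = \sum_(i < n) v ord0 i * partial i f x.
Proof.
move=> oA [_ Cf] Ax.
pose c i := partial i f x.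
have cL : continuous (row_form c) := @row_form_continuous R n c.
have o : f \o shift x = cst (f x) + row_form c +o_ (0 : 'rV[R]_n) id.
  apply/eqaddoP => e e0.
  (* Chosen so that [n * e' <= e]; the successor avoids a division by zero when [n = 0]. *)
  pose e' := e / n.+1%:R.
  have e'0 : 0 < e' by rewrite divr_gt0.
  have : \forall y \near x, A y /\ forall i, `|partial i f y - c i| <= e'.
    near=> y; split; first by near: y; exact: open_nbhs_nbhs.
    near: y; apply: filter_forall => i.
    have [_ /cvgrPdist_le/(_ _ e'0)] := Cf i x Ax.
    by apply: filterS => y; rewrite distrC.
  move=> /nbhs_ballP[d /= d0 Hd].
  near=> h.
  have hd : `|h| < d.
    near: h; apply/nbhs_ballP; exists d => //= z.
    by rewrite -ball_normE/= sub0r normrN.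
  have Hb y : `|y| <= `|h| -> ball x d (x + y).
    by move=> yh; rewrite -ball_normE/= opprD addrA subrr sub0r normrN (le_lt_trans yh).
  rewrite (_ : (_ - _) h = f (x + h) - f x - row_form c h); last first.
    by rewrite -[LHS]/(f (h + x) - (f x + row_form c h)) opprD addrA [h + x]addrC.
  have := @C1_on_increment R n f x h c e' (ltW e'0) _.
  move=> /(_ _)/le_trans; apply.
    move=> y /Hb/Hd[Ay Hy] i; split; last exact: Hy.
    by case: (Cf i _ Ay).
  rewrite mulrA ler_wpM2r//= /e' mulrCA ler_piMr ?(ltW e0)//.
  by rewrite ler_pdivrMr// mul1r ler_nat.
have dE : 'd f x = row_form c :> ('rV[R]_n -> R) by apply: diff_unique.
have df : differentiable f x by apply/diff_locallyP; rewrite dE.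
by split => // v; rewrite deriveE// dE.
Unshelve. all: by end_near. Qed.

(** * The Euclidean norm, its logarithm, and compact annuli *)

Lemma continuous_enorm (R : realType) (n : nat) : continuous (@enorm R n).
Proof.
move=> x; rewrite /enorm.
apply: (@continuous_comp _ _ _ (fun x : 'rV[R]_n => \sum_(i < n) x ord0 i ^+ 2) Num.sqrt).
  apply: (@continuous_sum R _ _ _ (fun i (v : 'rV[R]_n) => v ord0 i ^+ 2)) => i.
  have c := @coord_continuous R 1 n ord0 i x.
  by apply: (@continuousM _ _ (fun w : 'rV[R]_n => w ord0 i) (fun w : 'rV[R]_n => w ord0
    i)).
exact: sqrt_continuous.
Qed.

Lemma enorm_ge0 (R : realType) (n : nat) (x : 'rV[R]_n) : 0 <= enorm x.
Proof. exact: sqrtr_ge0. Qed.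

Lemma coord_le_enorm (R : realType) (n : nat) (x : 'rV[R]_n) i :
  `|x ord0 i| <= enorm x.
Proof.
rewrite /enorm -sqrtr_sqr ler_wsqrtr// (bigD1 i)//= lerDl sumr_ge0// => j _.
exact: sqr_ge0.
Qed.

Lemma enorm_eq0 (R : realType) (n : nat) (x : 'rV[R]_n) : (enorm x == 0) = (x == 0).
Proof.
apply/eqP/eqP => [x0|->].
  apply/rowP => i; rewrite mxE; apply/eqP; rewrite -normr_le0.
  by rewrite (le_trans (coord_le_enorm x i)) ?x0.
by rewrite /enorm big1 ?sqrtr0// => i _; rewrite mxE expr0n.
Qed.

Lemma enorm_gt0 (R : realType) (n : nat) (x : 'rV[R]_n) : x != 0 -> 0 < enorm x.
Proof. by rewrite lt_def enorm_ge0 enorm_eq0 => ->. Qed.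

Lemma enormZ (R : realType) (n : nat) (c : R) (x : 'rV[R]_n) :
  0 <= c -> enorm (c *: x) = c * enorm x.
Proof.
move=> c0; rewrite /enorm.
under eq_bigr do rewrite mxE exprMn.
by rewrite -mulr_sumr sqrtrM ?sqr_ge0// sqrtr_sqr ger0_norm.
Qed.

Lemma enorm_delta (R : realType) (n : nat) (i : 'I_n) :
  enorm (delta_mx ord0 i : 'rV[R]_n) = 1.
Proof.
rewrite /enorm (bigD1 i)//= big1 ?addr0.
  by rewrite mxE !eqxx expr1n sqrtr1.
by move=> j ji; rewrite mxE (negbTE ji) andbF expr0n.
Qed.

Definition lognorm (R : realType) (n : nat) (x : 'rV[R]_n) : R := ln (enorm x).

Lemma expR_lognorm (R : realType) (n : nat) (x : 'rV[R]_n) :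
  x != 0 -> expR (lognorm x) = enorm x.
Proof. by move=> x0; rewrite lnK// posrE enorm_gt0. Qed.

Lemma enorm_powR (R : realType) (n : nat) (x : 'rV[R]_n) (a : R) :
  x != 0 -> enorm x `^ a = expR (a * lognorm x).
Proof. by move=> x0; rewrite /powR enorm_eq0 (negbTE x0). Qed.

Lemma expZ_neq0 (R : realType) (n : nat) (x : 'rV[R]_n) (t : R) :
  x != 0 -> expR t *: x != 0.
Proof. by move=> x0; rewrite scaler_eq0 negb_or x0 andbT gt_eqF// expR_gt0. Qed.

Lemma lognormZ (R : realType) (n : nat) (x : 'rV[R]_n) (t : R) :
  x != 0 -> lognorm (expR t *: x) = t + lognorm x.
Proof.
move=> x0; rewrite /lognorm enormZ ?expR_ge0// lnM ?posrE ?expR_gt0 ?enorm_gt0//.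
by rewrite expRK.
Qed.

Lemma continuous_lognorm (R : realType) (n : nat) (x : 'rV[R]_n) :
  x != 0 -> {for x, continuous (@lognorm R n)}.
Proof.
move=> x0; apply: (@continuous_comp _ _ _ (@enorm R n) (@ln R)).
  exact: continuous_enorm.
by apply: continuous_ln; exact: enorm_gt0.
Qed.

(** A bounded piece of the cylinder. The origin is excluded explicitly because [ln 0] is 0 by
    convention. *)
Definition annulus (R : realType) (n : nat) (t1 t2 : R) : set 'rV[R]_n :=
  [set x | x != 0 /\ t1 <= lognorm x <= t2].

Lemma enorm_ball_compact (R : realType) (n : nat) (r : R) :
  compact [set x : 'rV[R]_n | enorm x <= r].
Proof.
apply: bounded_closed_compact.
  exists r; split; first exact: num_real.
  move=> y ry x /= xr.
  rewrite [leLHS]/Num.Def.normr/= mx_normrE; apply: bigmax_le => /=.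
    by rewrite (le_trans _ (ltW ry))// (le_trans (enorm_ge0 x)).
  by move=> [i j] _ /=; rewrite (ord1 i) (le_trans (coord_le_enorm x j))// (le_trans
    xr)// ltW.
apply: (@closed_comp _ _ (@enorm R n) [set y | y <= r]); last exact: closed_le.
by move=> x _; exact: continuous_enorm.
Qed.

Lemma annulus_compact (R : realType) (n : nat) (t1 t2 : R) :
  compact (@annulus R n t1 t2).
Proof.
have -> : @annulus R n t1 t2 = [set x | enorm x <= expR t2] `&` [set x | expR t1 <= enorm
  x].
  apply/seteqP; split=> x /=.
    by move=> [x0 /andP[]]; rewrite -[in X in X -> _]ler_expR -[in X in _ -> X ->
      _]ler_expR expR_lognorm.
  move=> [xt2 t1x].
  have x0 : x != 0 by rewrite -enorm_eq0 gt_eqF// (lt_le_trans _ t1x)// expR_gt0.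
  by split=> //; rewrite -ler_expR -[X in _ && X]ler_expR expR_lognorm// t1x xt2.
apply: compact_closedI; first exact: enorm_ball_compact.
apply: (@closed_comp _ _ (@enorm R n) [set y | expR t1 <= y]); last exact: closed_ge.
by move=> x _; exact: continuous_enorm.
Qed.

(** * Plane rotations, and derivatives along curves *)

Definition rotation (R : realType) (n : nat) (i j : 'I_n) (t : R) (x : 'rV[R]_n) :
    'rV[R]_n :=
  \row_l (if l == i then cos t * x ord0 i - sin t * x ord0 j
          else if l == j then cos t * x ord0 j + sin t * x ord0 i else x ord0 l).

(** The velocity field of the rotations in the (i, j)-plane, when [i != j]. *)
Definition rotation_field (R : realType) (n : nat) (i j : 'I_n) (x : 'rV[R]_n) :
    'rV[R]_n :=
  x ord0 i *: delta_mx ord0 j - x ord0 j *: delta_mx ord0 i.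

Lemma rotation0 (R : realType) (n : nat) (i j : 'I_n) (x : 'rV[R]_n) :
  rotation i j 0 x = x.
Proof.
apply/rowP => l; rewrite mxE cos0 sin0 !mul1r !mul0r subr0 addr0.
by case: eqVneq => [->//|_]; case: eqVneq => [->|].
Qed.

Lemma rotationZ (R : realType) (n : nat) (i j : 'I_n) (t c : R) (x : 'rV[R]_n) :
  rotation i j t (c *: x) = c *: rotation i j t x.
Proof. by apply/rowP => l; rewrite !mxE; do 2?case: ifP => _; ring. Qed.

Lemma enorm_rotation (R : realType) (n : nat) (i j : 'I_n) (t : R) (x : 'rV[R]_n) :
  i != j -> enorm (rotation i j t x) = enorm x.
Proof.
move=> ij; rewrite /enorm; congr Num.sqrt.
rewrite (bigD1 i)//= (bigD1 j) 1?eq_sym//= [RHS](bigD1 i)//= [X in _ = _ + X](bigD1 j)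
  1?eq_sym//=.
rewrite !mxE !eqxx eq_sym (negbTE ij) !addrA; congr (_ + _); last first.
  by apply: eq_bigr => l /andP[li lj]; rewrite mxE (negbTE li) (negbTE lj).
have C := cos2Dsin2 t.
transitivity ((cos t ^+ 2 + sin t ^+ 2) * (x ord0 i ^+ 2 + x ord0 j ^+ 2)); first by ring.
by rewrite C mul1r.
Qed.

Lemma lognorm_rotation (R : realType) (n : nat) (i j : 'I_n) (t : R) (x : 'rV[R]_n) :
  i != j -> lognorm (rotation i j t x) = lognorm x.
Proof. by move=> ij; rewrite /lognorm enorm_rotation. Qed.

Lemma rotation_neq0 (R : realType) (n : nat) (i j : 'I_n) (t : R) (x : 'rV[R]_n) :
  i != j -> x != 0 -> rotation i j t x != 0.
Proof. by move=> ij; rewrite -!enorm_eq0 enorm_rotation. Qed.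

Lemma is_derive_row (R : realType) (n : nat) (c : R -> 'rV[R]_n) (t : R) (v : 'rV[R]_n) :
  (forall l, is_derive t 1 (fun s => c s ord0 l) (v ord0 l)) -> is_derive t 1 c v.
Proof.
move=> H.
have D : derivable c t 1.
  by apply/derivable_mxP => i j; rewrite (ord1 i); case: (H j).
split=> //; rewrite derive_mx//; apply/rowP => j; rewrite mxE.
by case: (H j).
Qed.

Lemma is_derive_curve (R : realType) (V : normedModType R) (F : V -> R) (c : R -> V)
    (t : R) (v : V) :
  differentiable F (c t) -> is_derive t 1 c v ->
  is_derive t 1 (F \o c) ('D_v F (c t)).
Proof.
move=> dF [dc <-].
have dc' : differentiable c t by apply/derivable1_diffP.
have dFc : differentiable (F \o c) t by exact: differentiable_comp.
split; first exact/derivable1_diffP.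
by rewrite deriveE// diff_comp//= -!deriveE.
Qed.

Lemma is_derive_rotation (R : realType) (n : nat) (i j : 'I_n) (t : R) (x : 'rV[R]_n) :
  i != j ->
  is_derive t 1 (fun s => rotation i j s x) (rotation_field i j (rotation i j t x)).
Proof.
move=> ij; apply: is_derive_row => l; rewrite !mxE !eqxx/= [j == i]eq_sym (negbTE ij).
under eq_fun do rewrite mxE.
have [->|li] := eqVneq l i.
  rewrite (negbTE ij) mulr0 sub0r mulr1.
  by apply: is_derive_eq; rewrite /GRing.scale/=; ring.
case: (eqVneq l j) => [lj|lj].
  rewrite mulr0 subr0 mulr1.
  by apply: is_derive_eq; rewrite /GRing.scale/=; ring.
by rewrite !mulr0 subr0; exact: is_derive_cst.
Qed.

Lemma is_derive_expZ (R : realType) (n : nat) (t : R) (x : 'rV[R]_n) :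
  is_derive t 1 (fun s => expR s *: x) (expR t *: x).
Proof.
apply: is_derive_row => l; rewrite mxE.
under eq_fun do rewrite mxE.
by apply: is_derive_eq; rewrite /GRing.scale/=; ring.
Qed.

(** * The equation on the cylinder and the polar form of the Laplacian *)

(* cyl_r and cyl_rr are the first two derivatives in t = ln |x|, cyl_t i j and cyl_tt i j those
   along the rotations of the (i, j)-plane.  Since i and j range over ordered pairs, half
     the
   sum of the cyl_tt i j is the spherical Laplacian. *)
Record cylinder_solution (R : realType) (n : nat) (k b p : R) := CylinderSolution {
  cyl :> 'rV[R]_n -> R;
  cyl_r : 'rV[R]_n -> R;
  cyl_rr : 'rV[R]_n -> R;
  cyl_t : 'I_n -> 'I_n -> 'rV[R]_n -> R;
  cyl_tt : 'I_n -> 'I_n -> 'rV[R]_n -> R;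
  cyl_gt0 : forall x : 'rV[R]_n, x != 0 -> 0 < cyl x;
  cyl_continuous : forall x : 'rV[R]_n, x != 0 -> {for x, continuous cyl};
  cyl_r_continuous : forall x : 'rV[R]_n, x != 0 -> {for x, continuous cyl_r};
  cyl_is_derive : forall (x : 'rV[R]_n) (t : R), x != 0 ->
    is_derive t 1 (fun s : R => cyl (expR s *: x)) (cyl_r (expR t *: x));
  cyl_r_is_derive : forall (x : 'rV[R]_n) (t : R), x != 0 ->
    is_derive t 1 (fun s : R => cyl_r (expR s *: x)) (cyl_rr (expR t *: x));
  cyl_is_derive_rotation : forall i j (x : 'rV[R]_n) (t : R), i != j -> x != 0 ->
    is_derive t 1 (fun s : R => cyl (rotation i j s x)) (cyl_t i j (rotation i j t x));
  cyl_t_is_derive_rotation : forall i j (x : 'rV[R]_n) (t : R), i != j -> x != 0 ->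
    is_derive t 1 (fun s : R => cyl_t i j (rotation i j s x))
      (cyl_tt i j (rotation i j t x));
  cyl_equation : forall x : 'rV[R]_n, x != 0 ->
    cyl_rr x + 2^-1 * (\sum_i \sum_(j | j != i) cyl_tt i j x) =
    k ^+ 2 * cyl x - expR (b * lognorm x) * cyl x `^ p }.

Lemma punctured_open (R : realType) (n : nat) : open [set x : 'rV[R]_n | x != 0].
Proof.
rewrite (_ : [set _ | _] = ~` [set 0]); last by apply/seteqP; split => x /eqP.
apply: closed_openC; apply: accessible_closed_set1; apply: hausdorff_accessible.
exact: norm_hausdorff.
Qed.

(* The mixed terms h i j and h j i cancel without assuming h symmetric, so that the symmetry
   of second derivatives is never needed. *)
Lemma polar_identity (R : realType) (n : nat) (x d : 'I_n -> R) (h : 'I_n -> 'I_n -> R) :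
  \sum_i (x i * d i + x i * \sum_l x l * h l i) +
  2^-1 * (\sum_i \sum_(j | j != i) (- (x j * d j) - x i * d i + x i ^+ 2 * h j j
    + x j ^+ 2 * h i i - (x i * x j * h i j + x i * x j * h j i))) =
  (\sum_i x i ^+ 2) * (\sum_i h i i) - (n%:R - 2) * \sum_i x i * d i.
Proof.
set e := \sum_i x i * d i; set N := \sum_i x i ^+ 2; set l := \sum_i h i i.
pose q := \sum_i \sum_j x i * x j * h j i.
have q' : \sum_i \sum_j x i * x j * h i j = q.
  rewrite exchange_big/= /q; apply: eq_bigr => i _; apply: eq_bigr => j _.
  by rewrite (mulrC (x i)).
pose f i j := - (x j * d j) - x i * d i + x i ^+ 2 * h j j
    + x j ^+ 2 * h i i - (x i * x j * h i j + x i * x j * h j i).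
have -> : \sum_i (x i * d i + x i * \sum_l x l * h l i) = e + q.
  rewrite big_split/=; congr (_ + _); apply: eq_bigr => i _.
  by rewrite mulr_sumr; apply: eq_bigr => j _; rewrite mulrA.
(* The diagonal term [f i i] equals -2 [x i * d i], so omitting it adds the correction on the
   right. *)
have inner i : \sum_(j | j != i) f i j = \sum_j f i j + 2 * (x i * d i).
  rewrite [X in _ = X + _](bigD1 i isT) /= addrAC.
  by rewrite (_ : f i i + _ = 0) ?add0r// /f; ring.
rewrite (eq_bigr _ (fun i _ => inner i)) big_split/= -mulr_sumr -/e.
have -> : \sum_i \sum_j f i j = 2 * (N * l) - 2 * q - 2 * (n%:R * e).
  rewrite /f.
  under eq_bigr do rewrite !big_split/= !sumrN !big_split/=.
  rewrite !big_split/= !sumrN !big_split/= q' -/q.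
  have c1 : \sum_(i < n) \sum_(j < n) x j * d j = n%:R * e.
    by rewrite sumr_const card_ord mulr_natl.
  have c2 : \sum_(i < n) \sum_(j < n) x i * d i = n%:R * e.
    by rewrite exchange_big/= c1.
  have c3 : \sum_(i < n) \sum_(j < n) x i ^+ 2 * h j j = N * l.
    by rewrite /N mulr_suml; apply: eq_bigr => i _; rewrite mulr_sumr.
  have c4 : \sum_(i < n) \sum_(j < n) x j ^+ 2 * h i i = N * l.
    by rewrite exchange_big/= c3.
  by rewrite c1 c2 c3 c4; ring.
by field.
Qed.

(** * From the equation on the punctured space to the cylinder *)

Section PolarCoordinates.
Variables (R : realType) (n : nat) (u : 'rV[R]_n -> R).
Hypothesis C2u : C2_on [set x : 'rV[R]_n | x != 0] u.

(** The Euler operator, that is the derivative in t = ln |x|; [radial_derivative2] is its square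
    applied to [u]. *)
Definition radial_derivative (x : 'rV[R]_n) : R :=
  \sum_(i < n) x ord0 i * partial i u x.

Definition radial_derivative2 (x : 'rV[R]_n) : R :=
  \sum_(i < n) (x ord0 i * partial i u x +
    x ord0 i * \sum_(l < n) x ord0 l * partial l (partial i u) x).

Definition angular_derivative (i j : 'I_n) (x : 'rV[R]_n) : R :=
  x ord0 i * partial j u x - x ord0 j * partial i u x.

Definition angular_derivative2 (i j : 'I_n) (x : 'rV[R]_n) : R :=
  - (x ord0 j * partial j u x) - x ord0 i * partial i u x
  + x ord0 i ^+ 2 * partial j (partial j u) x
  + x ord0 j ^+ 2 * partial i (partial i u) x
  - (x ord0 i * x ord0 j * partial i (partial j u) x
     + x ord0 i * x ord0 j * partial j (partial i u) x).

Lemma differentiable_u (x : 'rV[R]_n) : x != 0 -> differentiable u x.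
Proof.
move=> x0; case: C2u => C1u _.
by have [] := C1_on_differentiable (@punctured_open R n) C1u x0.
Qed.

Lemma derive_u (x v : 'rV[R]_n) : x != 0 -> 'D_v u x = \sum_(i < n) v ord0 i * partial i
  u x.
Proof.
move=> x0; case: C2u => C1u _.
by have [_] := C1_on_differentiable (@punctured_open R n) C1u x0; apply.
Qed.

Lemma differentiable_partial i (x : 'rV[R]_n) : x != 0 -> differentiable (partial i u) x.
Proof.
move=> x0; case: C2u => _ /(_ i) C1u.
by have [] := C1_on_differentiable (@punctured_open R n) C1u x0.
Qed.

Lemma derive_partial i (x v : 'rV[R]_n) : x != 0 ->
  'D_v (partial i u) x = \sum_(l < n) v ord0 l * partial l (partial i u) x.
Proof.
move=> x0; case: C2u => _ /(_ i) C1u.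
by have [_] := C1_on_differentiable (@punctured_open R n) C1u x0; apply.
Qed.

Lemma is_derive_partial i (x v : 'rV[R]_n) : x != 0 ->
  is_derive x v (partial i u) (\sum_(l < n) v ord0 l * partial l (partial i u) x).
Proof.
move=> x0; rewrite -derive_partial//; apply: derivableP.
by apply: diff_derivable; exact: differentiable_partial.
Qed.

Lemma is_derive_coord i (x v : 'rV[R]_n) :
  is_derive x v (fun y : 'rV[R]_n => y ord0 i : R) (v ord0 i).
Proof.
have d : derivable (@id 'rV[R]_n) x v by [].
split; first by have /derivable_mxP/(_ ord0 i) := d.
by have := derive_mx d; rewrite derive_id => {2}->; rewrite mxE.
Qed.

Lemma differentiable_monomial i j (x : 'rV[R]_n) : x != 0 ->
  differentiable (fun y : 'rV[R]_n => y ord0 i * partial j u y) x.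
Proof.
move=> x0; apply: (@differentiableM _ _ (fun y : 'rV[R]_n => y ord0 i)).
  exact: differentiable_coord.
exact: differentiable_partial.
Qed.

Lemma is_derive_monomial i j (x v : 'rV[R]_n) (c s : R) :
  x != 0 -> v ord0 i = c -> \sum_(l < n) v ord0 l * partial l (partial j u) x = s ->
  is_derive x v (fun y : 'rV[R]_n => y ord0 i * partial j u y)
    (c * partial j u x + x ord0 i * s).
Proof.
move=> x0 <- <-.
have D := @is_deriveM _ _ (fun y : 'rV[R]_n => y ord0 i) (partial j u) x v _ _
  (is_derive_coord i x v) (is_derive_partial j v x0).
by apply: is_derive_eq D _; rewrite /GRing.scale/=; ring.
Qed.

Lemma differentiable_radial (x : 'rV[R]_n) : x != 0 -> differentiable radial_derivative x.
Proof.
move=> x0; rewrite (_ : radial_derivative =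
    \sum_(i < n) (fun y : 'rV[R]_n => y ord0 i * partial i u y)).
  by apply: differentiable_sum => i; exact: differentiable_monomial.
by apply/funext => y; rewrite fct_sumE.
Qed.

Lemma derive_radial (x : 'rV[R]_n) : x != 0 -> 'D_x radial_derivative x =
  radial_derivative2 x.
Proof.
move=> x0; rewrite (_ : radial_derivative =
    \sum_(i < n) (fun y : 'rV[R]_n => y ord0 i * partial i u y)); last first.
  by apply/funext => y; rewrite fct_sumE.
have D := @is_derive_sum _ _ _ n (fun i (y : 'rV[R]_n) => y ord0 i * partial i u y) x x _
  (fun i => is_derive_monomial x0 erefl erefl).
by rewrite (@derive_val _ _ _ _ _ _ _ D).
Qed.

Lemma differentiable_angular i j (x : 'rV[R]_n) : x != 0 ->
  differentiable (angular_derivative i j) x.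
Proof.
move=> x0; apply: (@differentiableB _ _ _ (fun y : 'rV[R]_n => y ord0 i * partial j u y)
  (fun y : 'rV[R]_n => y ord0 j * partial i u y)); exact: differentiable_monomial.
Qed.

Lemma sum_rotation_field i j (x : 'rV[R]_n) (c : 'I_n -> R) : i != j ->
  \sum_(l < n) rotation_field i j x ord0 l * c l = x ord0 i * c j - x ord0 j * c i.
Proof.
move=> ij; rewrite (bigD1 i)//= (bigD1 j) 1?eq_sym//= big1 ?addr0.
  by rewrite !mxE !eqxx/= [j == i]eq_sym (negbTE ij)/=; ring.
by move=> l /andP[li lj]; rewrite !mxE (negbTE li) (negbTE lj)/=; ring.
Qed.

Lemma derive_angular i j (x : 'rV[R]_n) : i != j -> x != 0 ->
  'D_(rotation_field i j x) (angular_derivative i j) x = angular_derivative2 i j x.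
Proof.
move=> ij x0.
have vi : rotation_field i j x ord0 i = - x ord0 j.
  by rewrite !mxE !eqxx (negbTE ij) /= mulr0 mulr1 sub0r.
have vj : rotation_field i j x ord0 j = x ord0 i.
  by rewrite !mxE !eqxx eq_sym (negbTE ij) /= mulr0 mulr1 subr0.
have sj := sum_rotation_field x (fun l => partial l (partial j u) x) ij.
have si := sum_rotation_field x (fun l => partial l (partial i u) x) ij.
have D := is_deriveB (is_derive_monomial x0 vi sj) (is_derive_monomial x0 vj si).
have E := @derive_val _ _ _ _ _ _ _ D.
rewrite -[LHS]/('D_(rotation_field i j x) ((fun y : 'rV[R]_n => y ord0 i * partial j u y) -
       (fun y : 'rV[R]_n => y ord0 j * partial i u y)) x) E /angular_derivative2.
move: (partial _ _ _) (partial _ _ _) (partial _ _ _) (partial _ _ _) (partial _ _ _)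
  (partial _ _ _).
move=> *; ring.
Qed.

(** The formula r^2 Lap = d_t^2 + (n - 2) d_t + Lap_S, from [polar_identity] with the gradient as
    [d] and the second partial derivatives as [h]. *)
Lemma polar_laplacian (x : 'rV[R]_n) :
  radial_derivative2 x + 2^-1 * (\sum_i \sum_(j | j != i) angular_derivative2 i j x) =
  enorm x ^+ 2 * laplacian u x - (n%:R - 2) * radial_derivative x.
Proof.
have -> : enorm x ^+ 2 = \sum_(i < n) x ord0 i ^+ 2.
  by rewrite sqr_sqrtr// sumr_ge0// => i _; exact: sqr_ge0.
exact: (polar_identity (fun i => x ord0 i) (fun i => partial i u x)
  (fun i j => partial i (partial j u) x)).
Qed.

Lemma is_derive_ray (x : 'rV[R]_n) (t : R) : x != 0 ->
  is_derive t 1 (fun s : R => u (expR s *: x)) (radial_derivative (expR t *: x)).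
Proof.
move=> x0; have x1 := expZ_neq0 t x0.
rewrite /radial_derivative -derive_u//.
by apply: (is_derive_curve (differentiable_u x1)); exact: is_derive_expZ.
Qed.

Lemma is_derive_ray2 (x : 'rV[R]_n) (t : R) : x != 0 ->
  is_derive t 1 (fun s : R => radial_derivative (expR s *: x))
    (radial_derivative2 (expR t *: x)).
Proof.
move=> x0; have x1 := expZ_neq0 t x0.
rewrite -(derive_radial x1).
by apply: (is_derive_curve (differentiable_radial x1)); exact: is_derive_expZ.
Qed.

Lemma is_derive_circle i j (x : 'rV[R]_n) (t : R) : i != j -> x != 0 ->
  is_derive t 1 (fun s : R => u (rotation i j s x))
    (angular_derivative i j (rotation i j t x)).
Proof.
move=> ij x0; have x1 := rotation_neq0 t ij x0.
rewrite /angular_derivative -(sum_rotation_field _ (fun l => partial l u _) ij) -derive_u//.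
by apply: (is_derive_curve (differentiable_u x1)); exact: is_derive_rotation.
Qed.

Lemma is_derive_circle2 i j (x : 'rV[R]_n) (t : R) : i != j -> x != 0 ->
  is_derive t 1 (fun s : R => angular_derivative i j (rotation i j s x))
    (angular_derivative2 i j (rotation i j t x)).
Proof.
move=> ij x0; have x1 := rotation_neq0 t ij x0.
rewrite -(derive_angular ij x1).
by apply: (is_derive_curve (differentiable_angular i j x1)); exact: is_derive_rotation.
Qed.

Variables (a p : R).
Hypothesis u_gt0 : forall x, 0 < u x.
Hypothesis equ : forall x : 'rV[R]_n, x != 0 -> equation_at a p u x.

(** With 2 k = n - 2, multiplication by |x|^k cancels the first-order term in t. *)
Let k : R := (n%:R - 2) / 2.

Let E (x : 'rV[R]_n) := expR (k * lognorm x).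

Lemma E_ray (x : 'rV[R]_n) (s : R) : x != 0 -> E (expR s *: x) = expR (k * s) * E x.
Proof. by move=> x0; rewrite /E lognormZ// mulrDr expRD. Qed.

Lemma is_derive_E x (t : R) : x != 0 ->
  is_derive t 1 (fun s : R => E (expR s *: x)) (k * E (expR t *: x)).
Proof.
move=> x0; under eq_fun do rewrite E_ray//.
by rewrite E_ray//; apply: is_derive_eq; rewrite /GRing.scale/=; ring.
Qed.

Lemma E_circle i j (x : 'rV[R]_n) (s : R) : i != j -> E (rotation i j s x) = E x.
Proof. by move=> ij; rewrite /E lognorm_rotation. Qed.

Lemma continuous_E (x : 'rV[R]_n) : x != 0 -> {for x, continuous E}.
Proof.
move=> x0; apply: (@continuous_comp _ _ _ (fun x => k * lognorm x) (@expR R)).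
  apply: (@continuousM _ _ (cst k) (@lognorm R n)); first exact: cst_continuous.
  exact: continuous_lognorm.
exact: continuous_expR.
Qed.

(** The second derivative of e^(k t) u in t is e^(k t) (k^2 u + 2 k u_t + u_tt), and the polar
    Laplacian turns the last two terms and the angular part into |x|^2 Lap u. The exponent [b]
    collects the powers of |x| left after writing u^p = |x|^(- k p) w^p. *)
Lemma emden_fowler : {w : cylinder_solution n k (k + 2 + a - k * p) p |
  forall x, w x = expR (k * lognorm x) * u x}.
Proof.
have dM (f f' h h' : R -> R) (t : R) : is_derive t 1 f (f' t) -> is_derive t 1 h (h' t) ->
    is_derive t 1 (fun s => f s * h s) (f' t * h t + f t * h' t).
  move=> D1 D2; apply: is_derive_eq (is_deriveM D1 D2) _.
  by rewrite /GRing.scale/=; ring.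
have dr (x : 'rV[R]_n) (t : R) : x != 0 -> is_derive t 1 (fun s : R => E (expR s *: x) *
  u (expR s *: x))
    (E (expR t *: x) * (k * u (expR t *: x) + radial_derivative (expR t *: x))).
  move=> x0.
  apply: is_derive_eq (dM (fun s => E (expR s *: x)) (fun s => k * E (expR s *: x))
    (fun s => u (expR s *: x)) (fun s => radial_derivative (expR s *: x)) t
    (is_derive_E t x0) (is_derive_ray t x0)) _.
  by move: (radial_derivative _) => *; ring.
have drr (x : 'rV[R]_n) (t : R) : x != 0 -> is_derive t 1
    (fun s : R => E (expR s *: x) * (k * u (expR s *: x) + radial_derivative (expR s *: x)))
    (E (expR t *: x) * (k ^+ 2 * u (expR t *: x) + 2 * k * radial_derivative (expR t *: x)
       + radial_derivative2 (expR t *: x))).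
  move=> x0.
  have D : is_derive t 1 (fun s : R => k * u (expR s *: x) + radial_derivative (expR s *:
    x))
     (k * radial_derivative (expR t *: x) + radial_derivative2 (expR t *: x)).
    have D1 := is_derive_ray t x0; have D2 := is_derive_ray2 t x0.
    exact: (is_deriveD (is_deriveZ k D1) D2).
  apply: is_derive_eq (dM (fun s => E (expR s *: x)) (fun s => k * E (expR s *: x))
    (fun s => k * u (expR s *: x) + radial_derivative (expR s *: x))
    (fun s => k * radial_derivative (expR s *: x) + radial_derivative2 (expR s *: x)) t
    (is_derive_E t x0) D) _.
  by move: (radial_derivative _) (radial_derivative2 _) => *; ring.
(* The weight [E] is constant along rotations, hence acts as a scalar on angular derivatives. *)
have dc i j (x : 'rV[R]_n) (t : R) (f f' : 'rV[R]_n -> R) : i != j ->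
    is_derive t 1 (fun s : R => f (rotation i j s x)) (f' (rotation i j t x)) ->
    is_derive t 1 (fun s : R => E (rotation i j s x) * f (rotation i j s x))
      (E (rotation i j t x) * f' (rotation i j t x)).
  move=> ij D; under eq_fun do rewrite E_circle//.
  rewrite (E_circle _ _ ij); exact: (is_deriveZ (E x) D).
have cu (x : 'rV[R]_n) : x != 0 -> {for x, continuous u}.
  by move=> x0; apply: differentiable_continuous; exact: differentiable_u.
pose g x := E x * u x.
pose g1 x := E x * (k * u x + radial_derivative x).
pose g2 x := E x * (k ^+ 2 * u x + 2 * k * radial_derivative x + radial_derivative2 x).
pose q1 i j x := E x * angular_derivative i j x.
pose q2 i j x := E x * angular_derivative2 i j x.
have g0 (x : 'rV[R]_n) : x != 0 -> 0 < g x by move=> x0; rewrite mulr_gt0// expR_gt0.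
have gc (x : 'rV[R]_n) : x != 0 -> {for x, continuous g}.
  by move=> x0; apply: (@continuousM _ _ E u); [exact: continuous_E|exact: cu].
have g1c (x : 'rV[R]_n) : x != 0 -> {for x, continuous g1}.
  move=> x0; apply: (@continuousM _ _ E (fun x => k * u x + radial_derivative x)).
    exact: continuous_E.
  apply: (@continuousD _ _ _ (fun x => k * u x) radial_derivative).
    by apply: (@continuousM _ _ (cst k) u); [exact: cst_continuous|exact: cu].
  by apply: differentiable_continuous; exact: differentiable_radial.
have geq (x : 'rV[R]_n) : x != 0 -> g2 x + 2^-1 * (\sum_i \sum_(j | j != i) q2 i j x) =
    k ^+ 2 * g x - expR ((k + 2 + a - k * p) * lognorm x) * g x `^ p.
  move=> x0.
  have S : \sum_i \sum_(j | j != i) q2 i j x =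
      E x * \sum_i \sum_(j | j != i) angular_derivative2 i j x.
    by rewrite mulr_sumr; apply: eq_bigr => i _; rewrite mulr_sumr.
  rewrite S mulrCA -mulrDr -addrA polar_laplacian.
  have -> : laplacian u x = - (enorm x `^ a * u x `^ p).
    by rewrite -(equ x0) opprK.
  have -> : enorm x ^+ 2 = expR (2 * lognorm x).
    by rewrite -(expR_lognorm x0) -expRM_natl.
  rewrite (enorm_powR _ x0).
  have -> : g x `^ p = expR (k * p * lognorm x) * u x `^ p.
    by rewrite powRM ?expR_ge0 ?(ltW (u_gt0 x))// /E -expRM mulrAC.
  have -> : expR ((k + 2 + a - k * p) * lognorm x) * (expR (k * p * lognorm x) * u x `^ p)
     = E x * (expR (2 * lognorm x) * (expR (a * lognorm x) * u x `^ p)).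
    by rewrite /E !mulrA -!expRD; congr (expR _ * _); ring.
  have -> : n%:R - 2 = 2 * k :> R by rewrite /k mulrC divfK.
  by rewrite /g; move: (radial_derivative _) => *; ring.
exists (@CylinderSolution R n k (k + 2 + a - k * p) p g g1 g2 q1 q2 g0 gc g1c dr drr
  (fun i j x t ij x0 => dc i j x t u _ ij (is_derive_circle t ij x0))
  (fun i j x t ij x0 => dc i j x t _ _ ij (is_derive_circle2 t ij x0)) geq).
by [].
Qed.

End PolarCoordinates.

(** * Auxiliary facts on compactness, powers and exponentials *)

Lemma derivable_continuous (R : realType) (f f' : R -> R) (t : R) :
  is_derive t 1 f (f' t) -> {for t, continuous f}.
Proof.
by move=> [d _]; apply: differentiable_continuous; exact/derivable1_diffP.
Qed.

(** Continuity is known at the points of [K] only, so the sublevel set need not be closed in [T]. A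
    cluster point in [K] is taken instead; [F > 0] there would hold on a neighbourhood missing the
    sublevel set. *)
Lemma compact_sublevel (R : realType) (T : topologicalType) (K : set T) (F : T -> R) :
  compact K -> (forall x, K x -> {for x, continuous F}) ->
  compact (K `&` [set x | F x <= 0]).
Proof.
move=> cK cF G PG GK.
have GK' : G K by apply: filterS GK => x [].
have [x [Kx xG]] := cK G PG GK'.
exists x; split=> //; split=> //=; rewrite leNgt; apply/negP => Fx.
have N : nbhs x [set z | 0 < F z].
  by have /cvgr_gt/(_ _ Fx) := cF x Kx.
have [z [[_ /= z1] /= z2]] := xG _ _ GK N.
by move: z1; rewrite leNgt z2.
Qed.

(** Mean value theorem; for [1 <= p] the derivative p z^(p - 1) is largest at the right end. *)
Lemma powR_tangent (R : realType) (p x y : R) : 1 <= p -> 0 < x -> x <= y ->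
  y `^ p - x `^ p <= p * y `^ (p - 1) * (y - x).
Proof.
move=> p1 x0 xy.
have D (z : R) : 0 < z -> is_derive z 1 (fun t => t `^ p) (p * z `^ (p - 1)).
  by move=> z0; exact: is_derive1_powR.
have [||z] := @MVT_segment R (fun t => t `^ p) (fun t => p * t `^ (p - 1)) x y xy.
- by move=> z; rewrite in_itv/= => /andP[xz _]; apply: D; exact: lt_trans xz.
- apply: derivable_within_continuous => z; rewrite in_itv/= => /andP[xz _].
  by case: (D z (lt_le_trans x0 xz)).
rewrite in_itv/= => /andP[xz zy] ->.
have z0 := lt_le_trans x0 xz.
rewrite ler_wpM2r ?subr_ge0// ler_wpM2l ?(le_trans ler01 p1)//.
by apply: ge0_ler_powR; rewrite ?nnegrE ?subr_ge0// ltW// (lt_le_trans z0).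
Qed.

Lemma expR_unbounded (R : realType) (c K M : R) : 0 < c -> 0 < K ->
  (* The witness makes K (1 + c t) equal to K + |M|, and e^s >= 1 + s. *)
  exists2 t, 0 <= t & M < K * expR (c * t).
Proof.
move=> c0 K0; exists (`|M| / (K * c)); first by rewrite divr_ge0// ltW// mulr_gt0.
apply: (@lt_le_trans _ _ (K * (1 + c * (`|M| / (K * c))))).
  have -> : K * (1 + c * (`|M| / (K * c))) = K + `|M|.
    by field; rewrite !gt_eqF.
  by rewrite ltr_pwDl// ler_norm.
by rewrite ler_pM2l// expR_ge1Dx.
Qed.

Lemma lognorm_surjective (R : realType) (n : nat) (t : R) : (0 < n)%N ->
  exists2 x : 'rV[R]_n, x != 0 & lognorm x = t.
Proof.
move=> n0; pose e : 'rV[R]_n := delta_mx ord0 (Ordinal n0).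
have e0 : e != 0 by rewrite -enorm_eq0 enorm_delta oner_eq0.
exists (expR t *: e); first exact: expZ_neq0.
by rewrite lognormZ// /lognorm enorm_delta ln1 addr0.
Qed.

Lemma annulus_min (R : realType) (n : nat) (f : 'rV[R]_n -> R) (t1 t2 : R) :
  (forall x, x != 0 -> {for x, continuous f}) -> @annulus R n t1 t2 !=set0 ->
  exists2 x, annulus t1 t2 x & forall z, annulus t1 t2 z -> f x <= f z.
Proof.
move=> cf ne.
have [] := @compact_EVT_min _ R f (@annulus R n t1 t2) ne (@annulus_compact R n t1 t2).
  apply: continuous_in_subspaceT => x; rewrite inE => -[x0 _]; exact: cf.
move=> x; rewrite inE => Ax xmin; exists x => // z Az; apply: xmin.
by rewrite inE.
Qed.

(** * Inversions in spheres about the origin *)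

(* The inversion in the sphere of radius e^s, i.e. t -> 2 s - t on the cylinder. *)
Definition reflection (R : realType) (n : nat) (s : R) (x : 'rV[R]_n) : 'rV[R]_n :=
  expR (2 * (s - lognorm x)) *: x.

Lemma reflection_neq0 (R : realType) (n : nat) (s : R) (x : 'rV[R]_n) :
  x != 0 -> reflection s x != 0.
Proof. exact: expZ_neq0. Qed.

Lemma lognorm_reflection (R : realType) (n : nat) (s : R) (x : 'rV[R]_n) :
  x != 0 -> lognorm (reflection s x) = 2 * s - lognorm x.
Proof. by move=> x0; rewrite lognormZ//; ring. Qed.

Lemma reflectionZ (R : realType) (n : nat) (s t : R) (x : 'rV[R]_n) :
  x != 0 -> reflection s (expR t *: x) = expR (- t) *: reflection s x.
Proof.
move=> x0; rewrite /reflection lognormZ// !scalerA -!expRD.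
by congr (expR _ *: _); ring.
Qed.

Lemma reflection_rotation (R : realType) (n : nat) (s t : R) i j (x : 'rV[R]_n) :
  i != j -> reflection s (rotation i j t x) = rotation i j t (reflection s x).
Proof. by move=> ij; rewrite /reflection lognorm_rotation// rotationZ. Qed.

Lemma reflection_id (R : realType) (n : nat) (x : 'rV[R]_n) :
  reflection (lognorm x) x = x.
Proof. by rewrite /reflection subrr mulr0 expR0 scale1r. Qed.

(** Joint continuity in plane and point, as the smallest bad plane is later sought in a compact set
    of pairs. *)
Lemma continuous_reflection (R : realType) (n : nat) (T : topologicalType)
    (s : T -> R) (x : T -> 'rV[R]_n) (q : T) :
  {for q, continuous s} -> {for q, continuous x} -> x q != 0 ->
  {for q, continuous (fun q => reflection (s q) (x q))}.
Proof.
move=> cs cx q0.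
have c1 : {for q, continuous (fun q => lognorm (x q))}.
  by apply: (@continuous_comp _ _ _ x (@lognorm R n)) => //; exact: continuous_lognorm.
have c2 : {for q, continuous (fun q => s q - lognorm (x q))}.
  exact: (@continuousB _ _ _ s (fun q => lognorm (x q)) q cs c1).
have c3 : {for q, continuous (fun q => 2 * (s q - lognorm (x q)))}.
  exact: (@continuousM _ _ (cst 2) _ q (@cst_continuous _ _ _ _) c2).
have c4 : {for q, continuous (fun q => expR (2 * (s q - lognorm (x q))))}.
  exact: (@continuous_comp _ _ _ _ (@expR R) q c3 (@continuous_expR R _)).
exact: (@continuousZ _ _ _ _ _ q c4 cx).
Qed.

(** * Maximum principles on the cylinder *)

Section Cylinder.
Variables (R : realType) (n : nat) (k b p : R) (w : cylinder_solution n k b p).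

(** By [cyl_equation], the value of w_tt + Lap_S w. *)
Definition cyl_operator (x : 'rV[R]_n) : R :=
  k ^+ 2 * w x - expR (b * lognorm x) * w x `^ p.

Lemma cyl_nonlinearity_gt0 (x : 'rV[R]_n) :
  x != 0 -> 0 < expR (b * lognorm x) * w x `^ p.
Proof. by move=> x0; rewrite mulr_gt0 ?expR_gt0// powR_gt0// cyl_gt0. Qed.

Lemma is_derive_shift_center (h h1 : R -> R) (c t : R) :
  (forall t : R, is_derive t 1 h (h1 t)) ->
  is_derive t 1 (fun s : R => h (c + s)) (h1 (c + t)).
Proof.
move=> H; have := @is_derive_affine R h c 1 t (h1 (c + 1 * t)) (H _).
by rewrite !mul1r; under eq_fun do rewrite mul1r.
Qed.

(** At a local minimum of w - h(t) the second derivatives along the ray and along every rotation are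
    nonnegative. As [h] depends on t alone, it enters only the radial one. *)
Lemma touching_below (h h1 h2 : R -> R) (x : 'rV[R]_n) (d : R) :
  (forall t : R, is_derive t 1 h (h1 t)) -> (forall t : R, is_derive t 1 h1 (h2 t)) ->
  x != 0 -> 0 < d ->
  (forall z, z != 0 -> `|lognorm z - lognorm x| < d ->
     w x - h (lognorm x) <= w z - h (lognorm z)) ->
  h2 (lognorm x) <= cyl_operator x.
Proof.
move=> dh dh1 x0 d0 xmin.
rewrite /cyl_operator -cyl_equation//.
have radial : 0 <= cyl_rr w x - h2 (lognorm x).
  pose f t := w (expR t *: x) - h (lognorm x + t).
  pose f1 t := cyl_r w (expR t *: x) - h1 (lognorm x + t).
  have D (t : R) : is_derive t 1 f (f1 t).
    exact: (is_deriveB (cyl_is_derive w t x0) (is_derive_shift_center _ t dh)).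
  have D1 : is_derive (0 : R) 1 f1 (cyl_rr w x - h2 (lognorm x)).
    have := is_deriveB (cyl_r_is_derive w 0 x0) (is_derive_shift_center (lognorm x) 0 dh1).
    by rewrite expR0 scale1r addr0.
  have [] := second_derivative_test D D1 d0; last by [].
  move=> t td; rewrite /f expR0 scale1r addr0 [lognorm x + t]addrC -(lognormZ t x0).
  by apply: xmin; [exact: expZ_neq0|rewrite lognormZ// addrK].
have angular i j : i != j -> 0 <= cyl_tt w i j x.
  move=> ij.
  have D (t : R) := cyl_is_derive_rotation w t ij x0.
  have D1 := cyl_t_is_derive_rotation w 0 ij x0.
  rewrite rotation0 in D1.
  have [] := second_derivative_test D D1 d0; last by [].
  move=> t _; rewrite rotation0.
  have := xmin _ (rotation_neq0 t ij x0).
  by rewrite lognorm_rotation// subrr normr0 lerD2r; exact.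
rewrite -subr_ge0 addrAC addr_ge0// mulr_ge0// sumr_ge0// => i _.
by rewrite sumr_ge0// => j ij; apply: angular; rewrite eq_sym.
Qed.

(** Reflection reverses t and commutes with rotations: radial second derivatives of the two terms
    subtract, while the first-order condition contains the sum of the [cyl_r]. *)
Lemma touching_reflection (h h1 h2 : R -> R) (s : R) (x : 'rV[R]_n) (d : R) :
  (forall t : R, is_derive t 1 h (h1 t)) -> (forall t : R, is_derive t 1 h1 (h2 t)) ->
  x != 0 -> 0 < d ->
  (forall z, z != 0 -> `|lognorm z - lognorm x| < d ->
     w (reflection s x) - w x - h (lognorm x) <=
     w (reflection s z) - w z - h (lognorm z)) ->
  cyl_r w (reflection s x) + cyl_r w x = - h1 (lognorm x) /\
  h2 (lognorm x) <= cyl_operator (reflection s x) - cyl_operator x.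
Proof.
move=> dh dh1 x0 d0 xmin.
have y0 := reflection_neq0 s x0; set y := reflection s x in y0 xmin *.
pose f t := w (expR (- t) *: y) - w (expR t *: x) - h (lognorm x + t).
pose f1 t := - cyl_r w (expR (- t) *: y) - cyl_r w (expR t *: x) - h1 (lognorm x + t).
have D (t : R) : is_derive t 1 f (f1 t).
  have D1 := is_derive_compN (cyl_is_derive w (- t) y0).
  exact: (is_deriveB (is_deriveB D1 (cyl_is_derive w t x0)) (is_derive_shift_center _ t
    dh)).
have D1 : is_derive (0 : R) 1 f1 (cyl_rr w y - cyl_rr w x - h2 (lognorm x)).
  have D1 := is_derive_compN (cyl_r_is_derive w (- 0) y0).
  have := is_deriveB (is_deriveB (is_deriveN D1) (cyl_r_is_derive w 0 x0))
    (is_derive_shift_center (lognorm x) 0 dh1).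
  by rewrite oppr0 opprK expR0 !scale1r addr0.
have [] := second_derivative_test D D1 d0.
  move=> t td; rewrite /f oppr0 expR0 !scale1r addr0.
  have := xmin _ (expZ_neq0 t x0).
  by rewrite lognormZ// addrK reflectionZ// -/y [t + lognorm x]addrC; exact.
rewrite /f1 oppr0 expR0 !scale1r addr0 => first radial; split.
  by apply/eqP; rewrite -subr_eq0 opprK -oppr_eq0 !opprD first.
rewrite /cyl_operator -!cyl_equation//.
have angular i j : i != j -> 0 <= cyl_tt w i j y - cyl_tt w i j x.
  move=> ij.
  have Dt (t : R) := is_deriveB (cyl_is_derive_rotation w t ij y0)
    (cyl_is_derive_rotation w t ij x0).
  have Dtt := is_deriveB (cyl_t_is_derive_rotation w 0 ij y0) (cyl_t_is_derive_rotation w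
    0 ij x0).
  rewrite !rotation0 in Dtt.
  have [] := second_derivative_test Dt Dtt d0; last by [].
  move=> t _; rewrite -![(_ - _) _]/(_ - _) !rotation0.
  have := xmin _ (rotation_neq0 t ij x0).
  rewrite lognorm_rotation// subrr normr0 reflection_rotation// -/y => /(_ d0).
  by rewrite lerD2r.
have sum_ge0 : 0 <= \sum_i \sum_(j | j != i) cyl_tt w i j y - \sum_i \sum_(j | j != i)
  cyl_tt w i j x.
  rewrite -sumrB sumr_ge0// => i _; rewrite -sumrB sumr_ge0// => j ij.
  by apply: angular; rewrite eq_sym.
move: radial sum_ge0; move: (cyl_rr w y) (cyl_rr w x) (h2 _) (\sum_i _) (\sum_i _) => *.
by lra.
Qed.

Lemma continuous_comp_lognorm (h h1 : R -> R) (x : 'rV[R]_n) :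
  (forall t : R, is_derive t 1 h (h1 t)) -> x != 0 ->
  {for x, continuous (fun z : 'rV[R]_n => h (lognorm z))}.
Proof.
move=> dh x0; apply: (@continuous_comp _ _ _ (@lognorm R n) h).
  exact: continuous_lognorm.
exact: derivable_continuous (dh _).
Qed.

(** At an interior negative minimum of w - h one would have h'' <= k^2 w - e^(b t) w^p < k^2 w <=
    k^2 h, against the assumption on [h]. *)
Lemma comparison (h h1 h2 : R -> R) (t1 t2 : R) :
  (forall t : R, is_derive t 1 h (h1 t)) -> (forall t : R, is_derive t 1 h1 (h2 t)) ->
  (forall t, t1 < t < t2 -> k ^+ 2 * h t <= h2 t) ->
  (forall x, x != 0 -> lognorm x = t1 \/ lognorm x = t2 -> h (lognorm x) <= w x) ->
  forall x, x != 0 -> t1 <= lognorm x <= t2 -> h (lognorm x) <= w x.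
Proof.
move=> dh dh1 hsub hend x0 x00 x0t; rewrite leNgt; apply/negP => x0lt.
have [||x [xn0 /andP[t1x xt2]] xmin] := @annulus_min R n (fun z => w z - h (lognorm z))
  t1 t2.
- move=> x xn0; apply: (@continuousB _ _ _ w (fun z : 'rV[R]_n => h (lognorm z))).
    exact: cyl_continuous.
  exact: continuous_comp_lognorm.
- by exists x0.
have xlt : w x < h (lognorm x).
  by rewrite -subr_lt0 (le_lt_trans (xmin x0 _))// subr_lt0.
have t1x' : t1 < lognorm x.
  rewrite lt_neqAle t1x andbT; apply/eqP => E.
  by have := hend x xn0 (or_introl (esym E)); rewrite leNgt xlt.
have xt2' : lognorm x < t2.
  rewrite lt_neqAle xt2 andbT; apply/eqP => E.
  by have := hend x xn0 (or_intror E); rewrite leNgt xlt.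
have d0 : 0 < Num.min (lognorm x - t1) (t2 - lognorm x) by rewrite lt_min !subr_gt0 t1x'.
have := touching_below dh dh1 xn0 d0 _.
have H z : z != 0 -> `|lognorm z - lognorm x| < Num.min (lognorm x - t1) (t2 - lognorm x) ->
    w x - h (lognorm x) <= w z - h (lognorm z).
  move=> z0; rewrite lt_min !ltr_norml => /andP[/andP[a1 a2] /andP[a3 a4]].
  by apply: xmin; split=> //; apply/andP; split; lra.
move=> /(_ H); rewrite leNgt => /negP; apply.
have tx : t1 < lognorm x < t2 by rewrite t1x' xt2'.
apply: lt_le_trans (hsub _ tx).
have := cyl_nonlinearity_gt0 xn0; rewrite /cyl_operator.
have := sqr_ge0 k; move: (expR _ * _) => N k0 N0.
have := ler_wpM2l k0 (ltW xlt); lra.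
Qed.

Lemma cyl_reflection_continuous (s : R) (x : 'rV[R]_n) : x != 0 ->
  {for x, continuous (fun z => w (reflection s z) - w z)}.
Proof.
move=> x0; apply: (@continuousB _ _ _ (fun z => w (reflection s z)) w); last exact:
  cyl_continuous.
apply: (@continuous_comp _ _ _ (fun z => reflection s z) w).
  apply: (@continuous_reflection R n _ (cst s) id x) => //; exact: cst_continuous.
by apply: cyl_continuous; exact: reflection_neq0.
Qed.

Lemma is_derive_exp_affine (c d t : R) :
  is_derive t 1 (fun t => expR (k * t) * (c + d * t))
    (expR (k * t) * ((k * c + d) + k * d * t)).
Proof. by apply: is_derive_eq; rewrite /GRing.scale/=; ring. Qed.

(** For h = e^(k t) (c + d t) one finds h'' - k^2 h = 2 k d e^(k t). *)
Lemma comparison_exp_affine (c d t1 t2 : R) : 0 <= k * d ->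
  (forall x, x != 0 -> lognorm x = t1 \/ lognorm x = t2 ->
    expR (k * lognorm x) * (c + d * lognorm x) <= w x) ->
  forall x, x != 0 -> t1 <= lognorm x <= t2 ->
    expR (k * lognorm x) * (c + d * lognorm x) <= w x.
Proof.
move=> kd.
apply: (@comparison _ _ _ t1 t2 (is_derive_exp_affine c d)
  (is_derive_exp_affine (k * c + d) (k * d))) => t _.
rewrite -subr_ge0 (_ : _ - _ = 2 * (k * d) * expR (k * t)); last by ring.
by rewrite mulr_ge0 ?expR_ge0// mulr_ge0.
Qed.

(** For e^(-k t) w, that is for [u], minima over spheres do not increase with the radius. Otherwise
    a function affine in t, equal to the minimum on the outer sphere and slightly decreasing
    inwards, would lie below it and yet exceed it at [x0]. *)
Lemma cyl_min_sphere (x0 : 'rV[R]_n) (t : R) : 0 <= k -> x0 != 0 -> lognorm x0 <= t ->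
  (0 < n)%N ->
  exists x, [/\ x != 0, lognorm x = t & w x <= expR (k * (t - lognorm x0)) * w x0].
Proof.
move=> k0 x00 x0t n0.
have [y y0 yt] := @lognorm_surjective R n t n0.
have [||x [xn0 xt] xmin] := @annulus_min R n w t t.
- exact: cyl_continuous.
- by exists y; split=> //; rewrite yt lexx.
have {}xt : lognorm x = t by apply/eqP; rewrite eq_le andbC.
exists x; split=> //; rewrite leNgt; apply/negP => Hlt.
pose m := expR (- (k * t)) * w x.
pose C := expR (- (k * lognorm x0)) * w x0.
have mC : C < m.
  rewrite /C /m -(@ltr_pM2l _ (expR (k * t))) ?expR_gt0// !mulrA -!expRD subrr expR0 mul1r.
  by rewrite -mulrBr.
have m0 : 0 < m by rewrite mulr_gt0 ?expR_gt0 ?cyl_gt0.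
(* In terms of u, the comparison function m - e (t - .) is negative far to the left, where
   therefore nothing has to be known about u. *)
pose e := (m - C) / (t - lognorm x0 + 1).
have tx1 : 0 < t - lognorm x0 + 1 by rewrite ltr_wpDl ?subr_ge0.
have e0 : 0 < e by rewrite divr_gt0 ?subr_gt0.
(* Thus the affine function takes the value C + e at [x0], which is too large. *)
have eE : e * (t - lognorm x0) + e = m - C.
  by rewrite -[X in _ + X]mulr1 -mulrDr /e divfK// gt_eqF.
pose t1 := Num.min (lognorm x0) (t - m / e).
have ke : 0 <= k * e by rewrite mulr_ge0// ltW.
have H : expR (k * lognorm x0) * (m - e * t + e * lognorm x0) <= w x0.
  apply: (comparison_exp_affine (t1 := t1) (t2 := t) ke) => //; last first.
    by rewrite x0t /t1 ge_min lexx.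
  move=> z z0 [zt|zt].
    apply: (@le_trans _ _ 0); last by rewrite ltW// cyl_gt0.
    rewrite pmulr_rle0 ?expR_gt0//.
    have : lognorm z <= t - m / e by rewrite zt /t1 ge_min lexx orbT.
    move=> /(ler_wpM2l (ltW e0)); rewrite mulrBr mulrCA divff ?gt_eqF// mulr1; lra.
  rewrite zt subrK /m mulrA -expRD subrr expR0 mul1r.
  by apply: xmin; split=> //; rewrite zt lexx.
have : m - e * t + e * lognorm x0 <= C.
  by rewrite /C expRN ler_pdivlMl ?expR_gt0.
by move: eE e0; rewrite mulrBr; lra.
Qed.

(** * Touching by sines, and the two nonexistence arguments *)

(** The largest multiple h of sin(t - t0) below [w] touches it at an interior [x], where h'' = -h =
    -w gives -w <= k^2 w - e^(b t) w^p. On the middle sphere the sine is 1, so [w] is there at least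
    the coefficient of h, hence at least [w x]. *)
Lemma sine_touching (t0 : R) : 0 < p -> (0 < n)%N ->
  exists x, [/\ x != 0, t0 <= lognorm x,
    expR (b * lognorm x) * w x `^ (p - 1) <= k ^+ 2 + 1 &
    forall z, z != 0 -> lognorm z = t0 + pi / 2 -> w x <= w z].
Proof.
move=> p0 n0.
have [y y0 yt] := @lognorm_surjective R n (t0 + pi / 2) n0.
(* The quotient sine over [w] is continuous up to both ends of the slab, unlike its inverse. *)
pose f z := - (sin (lognorm z - t0) / w z).
have piR := @pi_gt0 R.
have [||x [xn0 /andP[t0x xt0]] xmin] := @annulus_min R n f t0 (t0 + pi).
- move=> x x0.
  have c1 : {for x, continuous (fun z : 'rV[R]_n => sin (lognorm z - t0))}.
    apply: (@continuous_comp_lognorm (fun t => sin (t - t0)) (fun t => cos (t - t0))) =>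
      // t.
    by apply: is_derive_eq; rewrite /GRing.scale/=; ring.
  have c2 : {for x, continuous (fun z => (w z)^-1)}.
    apply: (@continuousV _ _ w); first by rewrite gt_eqF// cyl_gt0.
    exact: cyl_continuous.
  exact: (@continuousN _ _ _ _ x (@continuousM _ _ _ _ x c1 c2)).
- by exists y; split=> //; rewrite yt; apply/andP; split; lra.
have wx0 := cyl_gt0 w xn0.
have ymax z : z != 0 -> t0 <= lognorm z <= t0 + pi ->
    sin (lognorm z - t0) / w z <= sin (lognorm x - t0) / w x.
  by move=> z0 zt; rewrite -lerN2; apply: xmin.
(* Comparison with a point of the middle sphere; positivity keeps [x] off both ends. *)
have sx0 : 0 < sin (lognorm x - t0).
  have := ymax y y0; rewrite yt (_ : t0 + pi / 2 - t0 = pi / 2); last by ring.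
  rewrite sin_pihalf => H.
  have {}H : 1 / w y <= sin (lognorm x - t0) / w x by apply: H; apply/andP; split; lra.
  have : 0 < sin (lognorm x - t0) / w x.
    by apply: lt_le_trans H; rewrite div1r invr_gt0 cyl_gt0.
  by rewrite pmulr_lgt0// invr_gt0.
set s := sin (lognorm x - t0) in sx0 ymax *.
have le_w z : z != 0 -> t0 <= lognorm z <= t0 + pi ->
    w x / s * sin (lognorm z - t0) <= w z.
  move=> z0 zt; have := ymax z z0 zt.
  by rewrite ler_pdivrMr ?cyl_gt0// mulrAC ler_pdivlMr// [w x / s * _]mulrAC
    ler_pdivrMr// [w x * _]mulrC [w z * _]mulrC.
have t0x' : t0 < lognorm x.
  by rewrite lt_neqAle t0x andbT; apply/eqP => E; move: sx0; rewrite /s -E subrr sin0 ltxx.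
have xt0' : lognorm x < t0 + pi.
  rewrite lt_neqAle xt0 andbT; apply/eqP => E; move: sx0.
  by rewrite /s E addrAC subrr add0r sinpi ltxx.
exists x; split=> //.
- have d0 : 0 < Num.min (lognorm x - t0) (t0 + pi - lognorm x) by rewrite lt_min
  !subr_gt0 t0x'.
  have D1 (t : R) : is_derive t 1 (fun t => w x / s * sin (t - t0)) (w x / s * cos (t -
    t0)).
    by apply: is_derive_eq; rewrite /GRing.scale/=; ring.
  have D2 (t : R) : is_derive t 1 (fun t => w x / s * cos (t - t0)) (- (w x / s * sin (t
    - t0))).
    by apply: is_derive_eq; rewrite /GRing.scale/=; ring.
  have H z : z != 0 -> `|lognorm z - lognorm x| < Num.min (lognorm x - t0) (t0 + pi -
    lognorm x) ->
      w x - w x / s * sin (lognorm x - t0) <= w z - w x / s * sin (lognorm z - t0).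
    move=> z0; rewrite lt_min !ltr_norml => /andP[/andP[a1 a2] /andP[a3 a4]].
    rewrite -/s divfK ?gt_eqF// subrr subr_ge0.
    by apply: le_w => //; apply/andP; split; lra.
  have := touching_below D1 D2 xn0 d0 H.
  rewrite -/s divfK ?gt_eqF// /cyl_operator => T.
  rewrite -(@ler_pM2r _ (w x))// -mulrA [_ `^ _ * _]mulrC (mulr_powRB1 (ltW wx0) p0).
  by move: T; move: (expR _ * _) => N; lra.
- move=> z z0 zt; have := le_w z z0; rewrite zt.
  rewrite (_ : t0 + pi / 2 - t0 = pi / 2); last by ring.
  rewrite sin_pihalf mulr1 => H.
  apply: (@le_trans _ _ (w x / s)); last by apply: H; apply/andP; split; lra.
  by rewrite ler_pdivlMr// ler_piMr ?(ltW wx0)// /s sin_le1.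
Qed.

(** At the touching point w = O(e^(k t)). As p - 1 <= 0, e^(b t) w^(p - 1) is then at least a
    multiple of e^((b + k (p - 1)) t), which is unbounded. *)
Lemma sublinear_nonexistence : 0 < p -> p <= 1 -> 0 <= k -> 0 <= b ->
  0 < b + k * (p - 1) -> (0 < n)%N -> False.
Proof.
move=> p0 p1 k0 b0 g0 n0.
have [y y0 yt] := @lognorm_surjective R n 0 n0.
(* The factor independent of [t] in the final lower bound. *)
pose K := (expR (k * (pi / 2)) * w y) `^ (p - 1).
have K0 : 0 < K by rewrite powR_gt0// mulr_gt0 ?expR_gt0 ?cyl_gt0.
have [t t0 tK] := expR_unbounded (k ^+ 2 + 1) g0 K0.
have [x [xn0 tx Hx xz]] := sine_touching t p0 n0.
have piR := @pi_gt0 R.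
have tpi : lognorm y <= t + pi / 2 by rewrite yt addr_ge0// divr_ge0// ltW.
have [z [z0 zt wz]] := cyl_min_sphere k0 y0 tpi n0.
move: tK; rewrite ltNge => /negP; apply; apply: le_trans Hx.
rewrite yt subr0 mulrDr expRD -mulrA in wz.
have wxle := le_trans (xz z z0 zt) wz.
have -> : K * expR ((b + k * (p - 1)) * t) =
    expR (b * t) * (expR (k * t) * (expR (k * (pi / 2)) * w y)) `^ (p - 1).
  rewrite powRM ?expR_ge0 ?mulr_ge0 ?expR_ge0 ?(ltW (cyl_gt0 w y0))// -/K -expRM.
  by rewrite mulrA -expRD mulrC; congr (expR _ * _); ring.
apply: ler_pM; rewrite ?expR_ge0 ?powR_ge0//.
  by rewrite ler_expR ler_wpM2l.
have wx0 := cyl_gt0 w xn0.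
rewrite -[p - 1]opprB !powRN lef_pV2 ?posrE ?powR_gt0//; last exact: lt_le_trans wxle.
by apply: ge0_ler_powR; rewrite ?nnegrE ?subr_ge0// ?(ltW wx0)// (le_trans _ wxle)// ltW.
Qed.

(** The bound below makes e^(b t) w^(p - 1) at least c^(p - 1) e^(b t), which is unbounded, against
    [sine_touching]. *)
Lemma superlinear_nonexistence (c : R) : 0 < p -> 1 <= p -> 0 < b -> (0 < n)%N -> 0 < c ->
  (forall x, x != 0 -> 0 <= lognorm x -> c <= w x) -> False.
Proof.
move=> p0 p1 b0 n0 c0 wc.
have K0 : 0 < c `^ (p - 1) by rewrite powR_gt0.
have [t t0 tK] := expR_unbounded (k ^+ 2 + 1) b0 K0.
have [x [xn0 tx Hx _]] := sine_touching t p0 n0.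
move: tK; rewrite ltNge => /negP; apply; apply: le_trans Hx.
rewrite mulrC; apply: ler_pM; rewrite ?expR_ge0 ?powR_ge0//.
  by rewrite ler_expR ler_wpM2l// ltW.
have cx := wc x xn0 (le_trans t0 tx).
by apply: ge0_ler_powR; rewrite ?nnegrE ?subr_ge0// ltW// (lt_le_trans c0).
Qed.

(** * Lower bounds on spheres, and on t >= 0 when k = 0 *)

Lemma cyl_sphere_bound (t : R) : (0 < n)%N ->
  exists2 c, 0 < c & forall x, x != 0 -> lognorm x = t -> c <= w x.
Proof.
move=> n0; have [y y0 yt] := @lognorm_surjective R n t n0.
have [||x [xn0 _] xmin] := @annulus_min R n w t t.
- exact: cyl_continuous.
- by exists y; split=> //; rewrite yt lexx.
exists (w x); first exact: cyl_gt0.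
by move=> z z0 zt; apply: xmin; split=> //; rewrite zt lexx.
Qed.

(** For k = 0 affine functions of t are barriers. The line c - d t is nonpositive from t = c / d on,
    so positivity of [w] suffices at the far end; then the slope tends to 0. *)
Lemma flat_lower_bound : k = 0 -> (0 < n)%N ->
  exists2 c, 0 < c & forall x, x != 0 -> 0 <= lognorm x -> c <= w x.
Proof.
move=> k0 n0; have [c c0 wc] := cyl_sphere_bound 0 n0.
exists c => // x x0 xt; apply/ler_addgt0Pr => e e0.
(* This slope costs at most [e] at the given [x]. *)
pose d := e / (lognorm x + 1).
have x1 : 0 < lognorm x + 1 by rewrite ltr_wpDl.
have d0 : 0 < d by rewrite divr_gt0.
have kd : 0 <= k * - d by rewrite k0 mul0r.
have kt (t : R) : expR (k * t) = 1 by rewrite k0 mul0r expR0.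
have H : expR (k * lognorm x) * (c + - d * lognorm x) <= w x.
  apply: (comparison_exp_affine (t1 := 0) (t2 := Num.max (lognorm x) (c / d)) kd) => //.
    move=> z z0 [zt|zt]; rewrite kt mul1r.
      by rewrite zt mulr0 addr0 wc.
    have : c / d <= lognorm z by rewrite zt le_max lexx orbT.
    rewrite ler_pdivrMr// => H2; have := cyl_gt0 w z0; rewrite mulNr mulrC; lra.
  by rewrite xt le_max lexx.
move: H; rewrite kt mul1r mulNr => H.
have : d * lognorm x <= e.
  by rewrite /d mulrAC ler_pdivrMr// ler_pM2l// lerDl.
by move: H; move: (d * _) => q; lra.
Qed.

(** * Moving planes: monotonicity of w in t when k > 0 *)

Section MovingPlanes.
Hypotheses (p1 : 1 <= p) (k0 : 0 < k) (b0 : 0 < b) (n0 : (0 < n)%N).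
(** [C] bounds |x|^(-k) w = u on the punctured unit ball; this is the decay of [w] at t = -oo. *)
Variable C : R.
Hypothesis w_le : forall x, x != 0 -> lognorm x <= 0 -> w x <= C * expR (k * lognorm x).

Let is_derive_zero (t : R) : is_derive t 1 (fun=> 0 : R) (0 : R) := is_derive_cst 0 t 1.

(** [touching_reflection] with the zero barrier. *)
Lemma reflection_touching0 (s : R) (x : 'rV[R]_n) : x != 0 -> lognorm x < s ->
  (forall z, z != 0 -> lognorm z <= s ->
     w (reflection s x) - w x <= w (reflection s z) - w z) ->
  cyl_r w (reflection s x) + cyl_r w x = 0 /\
  0 <= cyl_operator (reflection s x) - cyl_operator x.
Proof.
move=> x0 xs xmin.
have d0 : 0 < s - lognorm x by rewrite subr_gt0.
have := touching_reflection is_derive_zero is_derive_zero x0 d0.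
move=> /(_ s) []; last by rewrite oppr0.
move=> z z0; rewrite !subr0 ltr_norml => /andP[_ zx].
by apply: xmin => //; rewrite ltW// -(ltrD2r (- lognorm x)).
Qed.

(** The reflected point lies farther out and b > 0. This strictness takes the place of a strong
    maximum principle. *)
Lemma nonlinearity_reflection_lt (s : R) (x : 'rV[R]_n) : x != 0 -> lognorm x < s ->
  w x <= w (reflection s x) ->
  expR (b * lognorm x) * w x `^ p <
  expR (b * lognorm (reflection s x)) * w (reflection s x) `^ p.
Proof.
move=> x0 xs wxy; have wx0 := cyl_gt0 w x0.
apply: (@lt_le_trans _ _ (expR (b * lognorm (reflection s x)) * w x `^ p)).
  rewrite ltr_pM2r ?powR_gt0// ltr_expR ltr_pM2l// lognorm_reflection//.
  by move: xs; move: (lognorm x) => *; lra.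
rewrite ler_pM2l ?expR_gt0//; apply: ge0_ler_powR => //; rewrite ?nnegrE.
- by rewrite (le_trans ler01).
- exact: ltW.
- by rewrite (le_trans (ltW wx0)).
Qed.

(** With y the reflected point, the hypotheses give k^2 (w x - w y) <= e^(b t) (w x^p - w y^p) <= p
    e^(b t) w x^(p - 1) (w x - w y) at t = ln |x|. The decay of [w] then yields k^2 <= q e^(g t),
    which bounds t below independently of the plane. *)
Lemma plane_start : 0 < b + k * (p - 1) -> exists2 T, T <= 0 &
  forall (s : R) (x : 'rV[R]_n), x != 0 -> lognorm x < s -> w (reflection s x) < w x ->
  0 <= cyl_operator (reflection s x) - cyl_operator x -> T <= lognorm x.
Proof.
move=> g0; set g := b + k * (p - 1) in g0.
have C0 : 0 < C.
  have [y y0 yt] := @lognorm_surjective R n 0 n0.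
  have yt' : lognorm y <= 0 by rewrite yt.
  have := lt_le_trans (cyl_gt0 w y0) (w_le y0 yt').
  by rewrite pmulr_lgt0// expR_gt0.
pose q := p * C `^ (p - 1).
have q0 : 0 < q by rewrite mulr_gt0 ?powR_gt0// (lt_le_trans ltr01).
(* The second entry solves k^2 = q e^(g t); the cap at 0 allows restricting to t < 0, where [w_le]
   applies. *)
exists (Num.min 0 (ln (k ^+ 2 / q) / g)); first by rewrite ge_min lexx.
move=> s x x0 xs wyx op.
rewrite ge_min; case: (leP 0 (lognorm x)) => //= xt.
have y0 := reflection_neq0 s x0; set y := reflection s x in y0 wyx op.
have wx0 := cyl_gt0 w x0; have wy0 := cyl_gt0 w y0.
have yx : lognorm x <= lognorm y.
  by rewrite /y lognorm_reflection//; move: xs; move: (lognorm x) => *; lra.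
have H1 : expR (b * lognorm x) * w y `^ p <= expR (b * lognorm y) * w y `^ p.
  by rewrite ler_pM2r ?powR_gt0// ler_expR ler_pM2l.
have H2 := powR_tangent p1 wy0 (ltW wyx).
have H3 : w x `^ (p - 1) <= C `^ (p - 1) * expR (k * (p - 1) * lognorm x).
  have -> : C `^ (p - 1) * expR (k * (p - 1) * lognorm x) =
      (C * expR (k * lognorm x)) `^ (p - 1).
    by rewrite powRM ?expR_ge0 ?(ltW C0)// -expRM; congr (_ * expR _); ring.
  apply: ge0_ler_powR; rewrite ?nnegrE ?subr_ge0// ?(ltW wx0)//.
    by rewrite mulr_ge0 ?expR_ge0 ?(ltW C0).
  by apply: w_le => //; exact: ltW.
have H4 : k ^+ 2 <= q * expR (g * lognorm x).
  rewrite -(@ler_pM2r _ (w x - w y)) ?subr_gt0//.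
  apply: (@le_trans _ _ (expR (b * lognorm x) * (w x `^ p - w y `^ p))).
    move: op; rewrite /cyl_operator mulrBr mulrBr.
    by move: H1; move: (expR _ * _) (expR _ * _) (expR _ * _) (k ^+ 2 * _) (k ^+ 2 * _)
      => *; lra.
  apply: (@le_trans _ _ (expR (b * lognorm x) * (p * w x `^ (p - 1) * (w x - w y)))).
    by rewrite ler_pM2l ?expR_gt0.
  rewrite mulrA ler_pM2r ?subr_gt0//.
  rewrite /q /g mulrDl expRD -mulrA mulrCA [C `^ _ * _]mulrCA ler_pM2l ?(lt_le_trans
    ltr01)//.
  by rewrite ler_pM2l ?expR_gt0.
rewrite ler_pdivrMr// -ler_expR lnK; last by rewrite posrE divr_gt0// exprn_gt0.
by rewrite ler_pdivrMr// mulrC [lognorm x * g]mulrC.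
Qed.

(** Far to the left [w] is below [d], so the difference exceeds -d there and a minimum over a
    compact annulus is global on t <= s. It is off the plane, where the difference vanishes. *)
Lemma negative_minimum (s : R) (x0 : 'rV[R]_n) : x0 != 0 -> lognorm x0 <= s ->
  w (reflection s x0) < w x0 ->
  exists x, [/\ x != 0, lognorm x < s, w (reflection s x) < w x &
    forall z, z != 0 -> lognorm z <= s ->
      w (reflection s x) - w x <= w (reflection s z) - w z].
Proof.
move=> x00 x0s x0lt.
pose d := w x0 - w (reflection s x0).
have d0 : 0 < d by rewrite subr_gt0.
have [t t0 Ht] : exists2 t, 0 <= t & C < d * expR (k * t) by exact: expR_unbounded.
pose t1 := Num.min (- t) (lognorm x0).
have small z : z != 0 -> lognorm z <= t1 -> w z < d.
  move=> z0 zt1.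
  have zt : lognorm z <= - t by rewrite (le_trans zt1)// /t1 ge_min lexx.
  apply: (@le_lt_trans _ _ (C * expR (k * lognorm z))).
    by apply: w_le => //; rewrite (le_trans zt)// oppr_le0.
  apply: (@lt_le_trans _ _ (d * expR (k * t) * expR (k * lognorm z))).
    by rewrite ltr_pM2r ?expR_gt0.
  rewrite -mulrA -expRD ler_piMr ?(ltW d0)// expR_le1 -mulrDr pmulr_rle0//.
  by move: zt; lra.
have [||x [xn0 /andP[t1x xs]] xmin] := @annulus_min R n (fun z => w (reflection s z) - w
  z) t1 s.
- by move=> x; exact: cyl_reflection_continuous.
- by exists x0; split=> //; rewrite x0s andbT /t1 ge_min lexx orbT.
have xle : w (reflection s x) - w x <= - d.
  rewrite opprB; apply: xmin; split=> //.
  by rewrite x0s andbT /t1 ge_min lexx orbT.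
exists x; split=> //.
- rewrite lt_neqAle xs andbT; apply/eqP => E.
  by move: xle; rewrite -E reflection_id subrr leNgt oppr_lt0 d0.
- by rewrite -subr_lt0 (le_lt_trans xle)// oppr_lt0.
- move=> z z0 zs; have [zt1|zt1] := leP t1 (lognorm z).
    by apply: xmin; split=> //; rewrite zt1.
  apply: (le_trans xle).
  have := small z z0 (ltW zt1); have := cyl_gt0 w (reflection_neq0 s z0).
  by move: (w (reflection s z)) (w z) => *; lra.
Qed.

(** The barrier e ((s - t) + (s - t)^2) lies below the reflected difference near the plane and
    vanishes on it with slope -e in t; the difference has slope -2 w_t there. *)
Lemma hopf_derivative (s : R) (x : 'rV[R]_n) :
  x != 0 -> lognorm x = s ->
  (forall z, z != 0 -> lognorm z < s -> w z < w (reflection s z)) ->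
  0 < cyl_r w x.
Proof.
move=> x0 xs wlt.
have k20 : 0 < k ^+ 2 by rewrite exprn_gt0.
(* The width d is so small that the barrier h below satisfies k^2 h <= h''. *)
pose d := (k ^+ 2 + 1)^-1.
have d0 : 0 < d by rewrite invr_gt0 addr_gt0.
have kd : k ^+ 2 * d <= 1.
  by rewrite /d ler_pdivrMr ?addr_gt0// mul1r lerDl.
have d1 : d <= 1 by rewrite /d invf_le1 ?addr_gt0// lerDr ltW.
have [||y [y0 yt] ymin] := @annulus_min R n (fun z => w (reflection s z) - w z) (s - d)
  (s - d).
- by move=> z; exact: cyl_reflection_continuous.
- exists (expR (- d) *: x); split; first exact: expZ_neq0.
  by rewrite lognormZ// xs addrC lexx.
have {}yt : lognorm y = s - d by apply/eqP; rewrite eq_le andbC.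
set m := w (reflection s y) - w y in ymin.
have m0 : 0 < m by rewrite subr_gt0 wlt// yt gtrBl.
(* Normalised so that the barrier equals [m] at t = s - d. *)
pose e := m / (d + d ^+ 2).
have dd0 : 0 < d + d ^+ 2 by rewrite addr_gt0// exprn_gt0.
have e0 : 0 < e by rewrite divr_gt0.
pose h t := e * ((s - t) + (s - t) ^+ 2).
pose h1 t := - (e * (1 + 2 * (s - t))).
have dh (t : R) : is_derive t 1 h (h1 t).
  by rewrite /h /h1; apply: is_derive_eq; rewrite /GRing.scale/=; ring.
have dh1 (t : R) : is_derive t 1 h1 (2 * e).
  by rewrite /h1; apply: is_derive_eq; rewrite /GRing.scale/=; ring.
have barrier z : z != 0 -> s - d <= lognorm z <= s ->
    h (lognorm z) <= w (reflection s z) - w z.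
  move=> z0 zt; rewrite leNgt; apply/negP => zlt.
  have [||q [q0 /andP[t1q qt2]] qmin] :=
    @annulus_min R n (fun z => w (reflection s z) - w z - h (lognorm z)) (s - d) s.
  - move=> z' z'0; apply: (@continuousB _ _ _ (fun z => w (reflection s z) - w z) (fun z
    : 'rV[R]_n => h (lognorm z))).
      exact: cyl_reflection_continuous.
    exact: continuous_comp_lognorm dh z'0.
  - by exists z.
  have qlt : w (reflection s q) - w q < h (lognorm q).
    by rewrite -subr_lt0 (le_lt_trans (qmin z _))// subr_lt0.
  have qs : lognorm q < s.
    rewrite lt_neqAle qt2 andbT; apply/eqP => E; move: qlt.
    by rewrite /h E subrr expr0n /= addr0 mulr0 -E reflection_id subrr ltxx.
  have qd : s - d < lognorm q.
    rewrite lt_neqAle t1q andbT; apply/eqP => E; move: qlt.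
    have : m <= w (reflection s q) - w q by apply: ymin; split=> //; rewrite -E lexx.
    by rewrite /h -E opprB addrCA subrr addr0 /e divfK ?gt_eqF// => /le_lt_trans H /H;
      rewrite ltxx.
  have r0 : 0 < Num.min (lognorm q - (s - d)) (s - lognorm q) by rewrite lt_min !subr_gt0
    qd.
  have H z' : z' != 0 -> `|lognorm z' - lognorm q| < Num.min (lognorm q - (s - d)) (s -
    lognorm q) ->
      w (reflection s q) - w q - h (lognorm q) <= w (reflection s z') - w z' - h (lognorm
        z').
    move=> z'0; rewrite lt_min !ltr_norml => /andP[/andP[a1 a2] /andP[a3 a4]].
    by apply: qmin; split=> //; apply/andP; split; lra.
  have [_] := touching_reflection dh dh1 q0 r0 H.
  rewrite leNgt => /negP; apply.
  have Q1 := nonlinearity_reflection_lt q0 qs (ltW (wlt q q0 qs)).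
  (* With r = s - ln |q| <= d, k^2 h = e k^2 r (1 + r), where k^2 r <= 1 and 1 + r <= 2. *)
  have Q2 : k ^+ 2 * (w (reflection s q) - w q) <= 2 * e.
    apply: (@le_trans _ _ (k ^+ 2 * h (lognorm q))); first by rewrite ler_pM2l// ltW.
    have sq0 : 0 <= s - lognorm q by rewrite subr_ge0 ltW.
    have sq1 : s - lognorm q <= d by move: qd; lra.
    rewrite /h mulrCA [2 * e]mulrC ler_pM2l// expr2 -[X in X + _]mulr1 -mulrDr mulrA.
    have : k ^+ 2 * (s - lognorm q) <= 1 by rewrite (le_trans _ kd)// ler_pM2l.
    move=> S1; apply: (@le_trans _ _ (1 * (1 + (s - lognorm q)))).
      by rewrite ler_wpM2r// addr_ge0.
    by rewrite mul1r; move: d1 sq1; lra.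
  by move: Q1 Q2; rewrite /cyl_operator mulrBr; move: (expR _ * _) (expR _ * _) (k ^+ 2 *
    _) (k ^+ 2 * _) => *; lra.
rewrite ltNge; apply/negP => wr.
(* Its slope at 0 is 2 w_t - e, negative if w_t <= 0, whereas the barrier forces f >= 0 for small t
   > 0. *)
pose f t := w (expR t *: x) - w (expR (- t) *: x) - e * t.
have D : is_derive (0 : R) 1 f (cyl_r w x + cyl_r w x - e).
  have D1 := is_derive_compN (cyl_is_derive w (- 0) x0).
  have D2 : is_derive (0 : R) 1 (fun t => e * t) e.
    by apply: is_derive_eq; rewrite /GRing.scale/=; ring.
  have := is_deriveB (is_deriveB (cyl_is_derive w 0 x0) D1) D2.
  by rewrite oppr0 expR0 !scale1r opprK.
have [|r r0 Hr] := derive_lt0_right D.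
  by move: wr e0; lra.
have mm : 0 < Num.min d r by rewrite lt_min d0 r0.
pose t := Num.min d r / 2.
have t0 : 0 < t by rewrite divr_gt0.
have : t < Num.min d r by rewrite /t ltr_pdivrMr// ltr_pMr// ltr1n.
rewrite lt_min => /andP[td tr].
have := Hr t; rewrite t0 tr => /(_ isT).
rewrite /f oppr0 expR0 scale1r subrr mulr0 subr0 ltNge => /negP; apply.
have z0 := expZ_neq0 (- t) x0.
have := barrier _ z0; rewrite /reflection lognormZ// xs scalerA -expRD.
rewrite (_ : 2 * (s - (- t + s)) + - t = t); last by ring.
have tt : s - d <= - t + s <= s by apply/andP; split; lra.
move=> /(_ tt); rewrite /h (_ : s - (- t + s) = t); last by ring.
by have := mulr_ge0 (ltW e0) (sqr_ge0 t); rewrite mulrDr; lra.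
Qed.

(** At the smallest plane carrying a candidate contact, all lower planes are good, so by continuity
    this one is too. The difference is then strictly positive off the plane, which pushes the
    contact onto the plane, where its vanishing derivative contradicts the Hopf lemma. *)
Lemma reflection_monotone (s0 : R) (x0 : 'rV[R]_n) : 0 < b + k * (p - 1) ->
  x0 != 0 -> lognorm x0 <= s0 -> w x0 <= w (reflection s0 x0).
Proof.
move=> g0 x00 x0s; rewrite leNgt; apply/negP => x0lt.
have [T _ HT] := plane_start g0.
(* Compact because the bound [T] serves all planes at once. *)
pose K : set (R * 'rV[R]_n) := `[T, s0]%classic `*` annulus T s0.
have cK : compact K by apply: compact_setX; [exact: segment_compact|exact: annulus_compact].
pose F1 (q : R * 'rV[R]_n) : R := lognorm q.2 - q.1.
pose F2 (q : R * 'rV[R]_n) : R := w (reflection q.1 q.2) - w q.2.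
(* The first-order contact condition, in closed form. On the plane, where [F2] vanishes identically,
   it still says w_t = 0. *)
pose F3 (q : R * 'rV[R]_n) : R := `|cyl_r w (reflection q.1 q.2) + cyl_r w q.2|.
have cfst (q : R * 'rV[R]_n) : {for q, continuous (fun q : R * 'rV[R]_n => q.1)} by
  exact: cvg_fst.
have csnd (q : R * 'rV[R]_n) : {for q, continuous (fun q : R * 'rV[R]_n => q.2)} by
  exact: cvg_snd.
have ccomp (f : 'rV[R]_n -> R) (q : R * 'rV[R]_n) : q.2 != 0 ->
    (forall x, x != 0 -> {for x, continuous f}) ->
    {for q, continuous (fun q : R * 'rV[R]_n => f q.2)}.
  by move=> q0 cf; exact: (@continuous_comp _ _ _ _ f q (csnd q) (cf _ q0)).
have ccompr (f : 'rV[R]_n -> R) (q : R * 'rV[R]_n) : q.2 != 0 ->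
    (forall x, x != 0 -> {for x, continuous f}) ->
    {for q, continuous (fun q : R * 'rV[R]_n => f (reflection q.1 q.2))}.
  move=> q0 cf; have cr := continuous_reflection (cfst q) (csnd q) q0.
  exact: (@continuous_comp _ _ _ _ f q cr (cf _ (reflection_neq0 _ q0))).
have cF1 q : K q -> {for q, continuous F1}.
  move=> [_ [q0 _]].
  exact: (@continuousB _ _ _ _ _ q (ccomp _ q q0 (@continuous_lognorm R n)) (cfst q)).
have cF2 q : K q -> {for q, continuous F2}.
  move=> [_ [q0 _]].
  exact: (@continuousB _ _ _ _ _ q (ccompr _ q q0 (@cyl_continuous _ _ _ _ _ w))
    (ccomp _ q q0 (@cyl_continuous _ _ _ _ _ w))).
have cF3 q : K q -> {for q, continuous F3}.
  move=> [_ [q0 _]].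
  have cS := @continuousD _ _ _ _ _ q (ccompr _ q q0 (@cyl_r_continuous _ _ _ _ _ w))
    (ccomp _ q q0 (@cyl_r_continuous _ _ _ _ _ w)).
  exact: (@continuous_comp _ _ _ _ (fun y : R => `|y|) q cS (@norm_continuous _ R _)).
(* A compact set of candidates for first contact; by negative_minimum and plane_start every
   bad plane s <= s0 contributes a point, and we look at the smallest such s. *)
pose B := ((K `&` [set q | F1 q <= 0]) `&` [set q | F2 q <= 0]) `&` [set q | F3 q <= 0].
have cB : compact B.
  apply: compact_sublevel; last by move=> q [[Kq _] _]; exact: cF3.
  apply: compact_sublevel; last by move=> q [Kq _]; exact: cF2.
  by apply: compact_sublevel.
have bad (s : R) z : z != 0 -> lognorm z <= s -> s <= s0 -> w (reflection s z) < w z ->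
    exists x, B (s, x).
  move=> z0 zs ss0 zlt.
  have [x [xn0 xs xlt xmin]] := negative_minimum z0 zs zlt.
  have [x1 x2] := reflection_touching0 xn0 xs xmin.
  have Tx := HT s x xn0 xs xlt x2.
  exists x; split; last by rewrite /F3 /= x1 normr0.
  split; last by rewrite /F2 /= subr_le0 ltW.
  split; last by rewrite /F1 /= subr_le0 ltW.
  split=> /=; first by rewrite in_itv/= ss0 (le_trans Tx (ltW xs)).
  by split=> //; rewrite Tx (le_trans (ltW xs)).
have neB : B !=set0.
  by have [x Bx] := bad s0 x0 x00 x0s (lexx s0) x0lt; exists (s0, x).
have [|q] := @compact_EVT_min _ R (fun q : R * 'rV[R]_n => q.1) B neB cB.
  by apply: continuous_in_subspaceT => q _; exact: cfst.
rewrite inE; move: q => [s x] [[[[/= sT [xn0 xT]]]]].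
rewrite /F1 /F2 /F3 /= !subr_le0 normr_le0 => xs xle xr qmin.
have ss0 : s <= s0 by move: sT; rewrite in_itv/= => /andP[].
have below (s' : R) z : z != 0 -> lognorm z <= s' -> s' < s -> w z <= w (reflection s' z).
  move=> z0 zs' ss'; rewrite leNgt; apply/negP => zlt.
  have [x' Bx'] := bad s' z z0 zs' (le_trans (ltW ss') ss0) zlt.
  by have := qmin (s', x'); rewrite inE /= leNgt ss' => /(_ Bx').
(* Scaling [z] by e^(- e / 2) and lowering the plane by e / 2 scales the reflected point by the same
   factor, so a strict failure at [s] would persist at a lower plane. *)
have at_s z : z != 0 -> lognorm z <= s -> w z <= w (reflection s z).
  move=> z0 zs; rewrite leNgt; apply/negP => zlt.
  have y0 := reflection_neq0 s z0.
  pose f t := w (expR t *: reflection s z) - w (expR t *: z).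
  have D (t : R) := is_deriveB (cyl_is_derive w t y0) (cyl_is_derive w t z0).
  have cf : {for (0 : R), continuous f}.
    exact: (@derivable_continuous R f (fun t => _) 0 (D 0)).
  have f0 : f 0 < 0 by rewrite /f expR0 !scale1r subr_lt0.
  have /cvgr_lt/(_ _ f0) := cf.
  move=> /nbhs_ballP[e /= e0 He].
  have e2 : 0 < e / 2 by rewrite divr_gt0.
  have := He (- (e / 2)); rewrite /ball/= sub0r opprK gtr0_norm// => /(_ _).
  have lt_e : e / 2 < e by rewrite ltr_pdivrMr// ltr_pMr// ltr1n.
  move=> /(_ lt_e); rewrite /f subr_lt0 ltNge => /negP; apply.
  have := below (s - e / 2) _ (expZ_neq0 (- (e / 2)) z0).
  rewrite lognormZ// addrC lerD2r gtrBl => /(_ zs e2).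
  rewrite /reflection lognormZ// !scalerA -!expRD.
  rewrite (_ : 2 * (s - e / 2 - (- (e / 2) + lognorm z)) + - (e / 2) =
    - (e / 2) + 2 * (s - lognorm z)) //.
  ring.
(* A zero of the difference would be a minimum, where the operator difference is nonnegative; but it
   reduces to the difference of the nonlinear terms, which is negative. *)
have strict z : z != 0 -> lognorm z < s -> w z < w (reflection s z).
  move=> z0 zs; rewrite lt_neqAle (at_s z z0 (ltW zs)) andbT; apply/eqP => E.
  have [] := reflection_touching0 z0 zs.
    by move=> z' z'0 z's; rewrite -E subrr subr_ge0 at_s.
  move=> _; have := nonlinearity_reflection_lt z0 zs (at_s z z0 (ltW zs)).
  by rewrite /cyl_operator -E; move: (expR _ * _) (expR _ * _) (k ^+ 2 * _) => *; lra.
have {}xs : lognorm x = s.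
  apply/eqP; move: xs; rewrite le_eqVlt => /orP[//|xs].
  by have := strict x xn0 xs; rewrite ltNge xle.
have := hopf_derivative xn0 xs strict.
by move: xr; rewrite -xs reflection_id -mulr2n mulrn_eq0/= => /eqP ->; rewrite ltxx.
Qed.

(** Each [x] with t >= 0 is the reflection, in the plane at t / 2, of a point of the unit sphere. *)
Lemma monotone_lower_bound : 0 < b + k * (p - 1) ->
  exists2 c, 0 < c & forall x, x != 0 -> 0 <= lognorm x -> c <= w x.
Proof.
move=> g0; have [c c0 wc] := cyl_sphere_bound 0 n0.
exists c => // x x0 xt.
have z0 := expZ_neq0 (- lognorm x) x0; set z := expR _ *: x in z0.
have zt : lognorm z = 0 by rewrite lognormZ// addNr.
apply: (le_trans (wc z z0 zt)).
have -> : x = reflection (lognorm x / 2) z.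
  rewrite /reflection zt scalerA -expRD (_ : _ + _ = 0) ?expR0 ?scale1r//.
  by field.
by apply: reflection_monotone => //; rewrite zt divr_ge0.
Qed.

End MovingPlanes.

End Cylinder.

(** * Conclusion for solutions on the whole space *)

(** Both regularity classes give the same information off the origin, together with continuity
    everywhere; the signs of [a] need no separate treatment afterwards. *)
Lemma solution_punctured (R : realType) (n : nat) (a p : R) (u : 'rV[R]_n -> R) :
  solution a p u ->
  [/\ C2_on [set x : 'rV[R]_n | x != 0] u, continuous u &
    forall x : 'rV[R]_n, x != 0 -> equation_at a p u x].
Proof.
move=> [[_ [[[cu du] C2u] equ]]|[_ [C2u [cu equ]]]]; last by split.
split; [|by move=> x; exact: cu|by move=> x _; exact: equ].
split; first by split=> [x _|i x _]; [exact: cu|exact: du].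
by move=> i; have [ci di] := C2u i; split=> [x _|j x _]; [exact: ci|exact: di].
Qed.

Theorem corollary1p3 (R : realType) (n : nat) (hn : (2 <= n)%N) (a : R)
    (ha : -2 < a) (p : R) (hp0 : 0 < p)
    (hp : (p%:E < critical_exponent n a)%E) :
  ~ exists u : 'rV[R]_n -> R, positive_solution a p u.
Proof.
move=> [u [/solution_punctured[C2u cu equ] u_gt0]].
have [w wE] := emden_fowler C2u u_gt0 equ.
set k : R := (n%:R - 2) / 2 in w wE *; set b := k + 2 + a - k * p in w wE *.
have n0 : (0 < n)%N by exact: ltn_trans hn.
have k0 : 0 <= k by rewrite divr_ge0// subr_ge0 (ler_nat _ 2 n).
(* Subcriticality enters here: b = (n - 2) (p_c - p) / 2 if n >= 3, and b = 2 + a if n = 2. *)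
have b0 : 0 < b.
  have -> : b = (n%:R + 2 + 2 * a - (n%:R - 2) * p) / 2 by rewrite /b /k; field.
  rewrite divr_gt0// subr_gt0; move: hp; rewrite /critical_exponent.
  case: ifPn => [n3|n3 _].
    by rewrite lte_fin ltr_pdivlMr ?subr_gt0 ?(ltr_nat _ 2 n)// mulrC.
  have -> : n = 2%N by apply/eqP; rewrite eqn_leq hn andbT leqNgt.
  by rewrite subrr mul0r; move: ha; lra.
(* The condition a > -2, since this sum equals 2 + a for every [p]. *)
have g0 : 0 < b + k * (p - 1).
  have -> : b + k * (p - 1) = 2 + a by rewrite /b; ring.
  by move: ha; lra.
have [p1|p1] := leP p 1; first exact: (sublinear_nonexistence w hp0 p1 k0 (ltW b0) g0 n0).
suff [c c0 wc] : exists2 c, 0 < c & forall x, x != 0 -> 0 <= lognorm x -> c <= w x.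
  exact: (superlinear_nonexistence hp0 (ltW p1) b0 n0 c0 wc).
move: k0; rewrite le_eqVlt => /orP[/eqP k0|k0].
  exact: (flat_lower_bound w (esym k0) n0).
(* Continuity of [u] at the origin gives its maximum on the closed unit ball, the constant in the
   decay of [w] at t = -oo. *)
have [|||z _ zmax] := @compact_EVT_max _ R u [set x : 'rV[R]_n | enorm x <= 1].
- by exists 0; rewrite /= /enorm big1 ?sqrtr0// => i _; rewrite mxE expr0n.
- exact: enorm_ball_compact.
- exact: continuous_subspaceT.
apply: (@monotone_lower_bound _ _ _ _ _ w (ltW p1) k0 b0 n0 (u z)) => // x x0 xt.
rewrite wE mulrC ler_pM2r ?expR_gt0//; apply: zmax; rewrite inE /=.
by rewrite -expR_lognorm// -[leRHS]expR0 ler_expR.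
Qed.
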